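(* There exists a partial algorithm which, given an automatic structure for a group $G$ with language of representatives $L$, and given finitely many reduced words generating a subgroup $H$ of $G$, stops and computes the Stallings graph $\Gamma_L(H)$ of $H$ with respect to $L$ if $H$ is $L$-quasi-convex, and never stops if $H$ is not $L$-quasi-convex.
   Context: Let $A$ be a finite alphabet with at least two letters, $\tilde A = A\cup A^{-1}$, $\tilde A^*$ the free monoid on $\tilde A$, and $F(A)\subset \tilde A^*$ the set of (freely) reduced words. $G$ is a group with an epimorphism $\mu\colon\tilde A^*\to G$ respecting inverses. Reduced words $h_1,\dots,h_s\in F(A)$ ''generate the subgroup $H$ of $G$'' if $H=\langle \mu(h_1),\dots,\mu(h_s)\rangle$. Automatic structure: a finite automaton accepting a language $L\subseteq\tilde A^*$ with $\mu(L)=G$ and, for each $a\in\tilde A\cup\{1\}$, a finite automaton accepting (with padding of the shorter word at its right end by a new symbol) the set of pairs $(u,v)\in L\times L$ with $\mu(ua)=\mu(v)$. It is always assumed that $L$ consists of reduced words. An $L$-representative of $g\in G$ is an element of $L\cap\mu^{-1}(g)$. $L$-quasi-convexity: $H\le G$ is $L$-quasi-convex if there is an integer $k$ such that for every $w\in L\cap\mu^{-1}(H)$, the path in the Cayley graph of $G$ (with respect to $A$) starting at $1$ and labeled $w$ stays within distance at most $k$ of $H$. Stallings graph: the Schreier graph $\mathrm{Schreier}(G,H)$ has vertices the cosets $Hg$ ($g\in G$) and edges $(Hg,a,Hg\mu(a))$ ($g\in G$, $a\in A$); the letter $a^{-1}$ is read by traversing an $a$-labeled edge backwards. The Stallings graph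 $\Gamma_L(H)$ of $H$ with respect to $L$ is the subgraph of $\mathrm{Schreier}(G,H)$, rooted at the vertex $H$, spanned by the loops at $H$ labeled by the elements of $L\cap\mu^{-1}(H)$. *)

(* Defs.v *)
From mathcomp Require Import all_boot.
From mathcomp Require Import boolp classical_sets functions.

Set Implicit Arguments.
Unset Strict Implicit.
Unset Printing Implicit Defensive.

Local Open Scope classical_set_scope.

(** * Partial algorithms

   The model of computation is the class of partial recursive functions, with
   finite binary trees (S-expressions) in the place of tuples of natural
   numbers: a constant, pairing and projections, composition, primitive
   recursion along trees, and unbounded minimisation.  Natural numbers are
   right combs of leaves. *)

Inductive tree := Leaf | Node of tree & tree.

Definition tfst t := if t is Node l _ then l else Leaf.
Definition tsnd t := if t is Node _ r then r else Leaf.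

Definition tnat (n : nat) : tree := iter n (Node Leaf) Leaf.

Inductive program :=
| PId
| PLeaf
| PFst
| PSnd
| PPair of program & program
| PComp of program & program
| PRec of program & program
| PMu of program.

(* The graph of the function defined by primitive recursion along a tree:
     r e Leaf = F e,
     r e (Node l r) = K (e, ((l, r), (r e l, r e r))). *)
Fixpoint rec_graph (F K : tree -> tree -> Prop) (e t v : tree) : Prop :=
  match t with
  | Leaf => F e v
  | Node l r => exists vl vr, [/\ rec_graph F K e l vl, rec_graph F K e r vr
      & K (Node e (Node (Node l r) (Node vl vr))) v]
  end.

(* [eval p x y]: on input [x] the program [p] stops with output [y].
   [PMu f] returns the least [n] such that [f] does not return [Leaf] on the
   pair [(x, n)], all the previous runs of [f] having stopped. *)
Fixpoint eval (p : program) (x y : tree) : Prop :=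
  match p with
  | PId => y = x
  | PLeaf => y = Leaf
  | PFst => y = tfst x
  | PSnd => y = tsnd x
  | PPair f g => exists y1 y2, [/\ eval f x y1, eval g x y2 & y = Node y1 y2]
  | PComp g f => exists2 z, eval f x z & eval g z y
  | PRec f g => rec_graph (eval f) (eval g) (tfst x) (tsnd x) y
  | PMu f => exists n, [/\ y = tnat n,
      exists2 v, eval f (Node x (tnat n)) v & v <> Leaf
      & forall m, (m < n)%N -> eval f (Node x (tnat m)) Leaf]
  end.

Definition halts (p : program) (x : tree) : Prop := exists y, eval p x y.

Lemma rec_graph_det (F K : tree -> tree -> Prop) e t v v' :
  (forall x y y', F x y -> F x y' -> y = y') ->
  (forall x y y', K x y -> K x y' -> y = y') ->
  rec_graph F K e t v -> rec_graph F K e t v' -> v = v'.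
Proof.
move=> detF detK; elim: t v v' => [|l IHl r IHr] v v' /=; first exact: detF.
move=> [vl [vr [Hl Hr Hv]]] [vl' [vr' [Hl' Hr' Hv']]].
move: Hv'; rewrite -(IHl _ _ Hl Hl') -(IHr _ _ Hr Hr'); exact: detK.
Qed.

Lemma eval_det p x y y' : eval p x y -> eval p x y' -> y = y'.
Proof.
elim: p x y y' => [||||f IHf g IHg|g IHg f IHf|f IHf g IHg|f IHf] x y y' /=;
  try by move=> -> ->.
- move=> [y1 [y2 [H1 H2 ->]]] [z1 [z2 [K1 K2 ->]]].
  by rewrite (IHf _ _ _ H1 K1) (IHg _ _ _ H2 K2).
- move=> [z Hz Hy] [z' Hz' Hy']; move: Hy'; rewrite -(IHf _ _ _ Hz Hz').
  exact: IHg.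
- exact: rec_graph_det.
- move=> [n [-> [v Hv nv] Hn]] [m [-> [w Hw nw] Hm]].
  case: (ltngtP n m) => [lt_nm|lt_mn|->] //.
  + by case: nv; apply: IHf Hv (Hm _ lt_nm).
  + by case: nw; apply: IHf Hw (Hn _ lt_mn).
Qed.

(** * Words *)

(* [(a, false)] is the letter [a] and [(a, true)] the letter [a^-1]. *)
Notation letter A := (A * bool)%type.
Notation word A := (seq (letter A)).

Definition linv (A : Type) (x : letter A) : letter A := (x.1, ~~ x.2).

Definition reduced (A : finType) (w : word A) : bool :=
  sorted (fun x y => y != linv x) w.

(** * Finite automata (possibly non-deterministic) *)

Record automaton (S : Type) := Automaton {
  nstates : nat;
  initial : seq 'I_nstates;
  final : seq 'I_nstates;
  transitions : seq ('I_nstates * S * 'I_nstates)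
}.

Section Automata.
Variables (S : eqType) (M : automaton S).

Fixpoint run (p : 'I_(nstates M)) (w : seq S) (q : 'I_(nstates M)) : Prop :=
  match w with
  | [::] => p = q
  | x :: w' => exists2 r, (p, x, r) \in transitions M & run r w' q
  end.

Definition accepted : set (seq S) := [set w |
  exists p q, [/\ p \in initial M, q \in final M & run p w q]].

End Automata.

(* [None] is the padding symbol. *)
Definition pad (S : Type) (u v : seq S) : seq (option S * option S) :=
  [seq (onth u i, onth v i) | i <- iota 0 (maxn (size u) (size v))].

(** * Groups, subgroups and automatic structures *)

Definition subgroup (G : groupType) (H : set G) : Prop :=
  [/\ H 1%g, (forall g h, H g -> H h -> H (g * h)%g)
    & (forall g, H g -> H (g^-1)%g)].

Definition inverse_epimorphism (A : finType) (G : groupType)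
    (mu : word A -> G) : Prop :=
  [/\ mu [::] = 1%g,
      (forall u v, mu (u ++ v) = (mu u * mu v)%g),
      (forall x, mu [:: linv x] = ((mu [:: x])^-1)%g)
    & (forall g, exists w, mu w = g)].

(* [H = < mu(h_1), ..., mu(h_s) >] *)
Definition generated (A : finType) (G : groupType) (mu : word A -> G)
    (hs : seq (word A)) : set G :=
  smallest (@subgroup G) (mu @` [set` hs]).

(* The automata of an automatic structure; [multiplier D None] is the one for
   multiplication by 1. *)
Record automata (A : Type) := Automata {
  representatives : automaton (letter A);
  multiplier : option (letter A) ->
    automaton (option (letter A) * option (letter A))
}.

Definition language (A : finType) (D : automata A) : set (word A) :=
  accepted (representatives D).

Definition automatic_structure (A : finType) (G : groupType)
    (mu : word A -> G) (D : automata A) : Prop :=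
  let L := language D in
  [/\ (forall w, L w -> reduced w),
      mu @` L = setT
    & forall a : option (letter A),
        accepted (multiplier D a) =
        [set z | exists u v, [/\ L u, L v, mu (u ++ seq_of_opt a) = mu v
                                & z = pad u v]]].

(** * Quasi-convexity *)

(* [g] and [h] are at distance at most [k] in the Cayley graph. *)
Definition cayley_dist_le (A : finType) (G : groupType) (mu : word A -> G)
    (g h : G) (k : nat) : Prop :=
  exists2 w : word A, (size w <= k)%N & (g * mu w)%g = h.

(* The vertices of the path labeled [w] starting at 1 are the [mu u] for the
   prefixes [u] of [w]. *)
Definition quasi_convex (A : finType) (G : groupType) (mu : word A -> G)
    (L : set (word A)) (H : set G) : Prop :=
  exists k : nat, forall w, (L `&` mu @^-1` H) w ->
    forall u, prefix u w -> exists2 h, H h & cayley_dist_le mu (mu u) h k.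

(** * Labeled rooted graphs *)

Record rooted_graph (A V : Type) := RootedGraph {
  vertices : set V;
  root : V;
  edges : set (V * A * V)
}.

Section Graphs.
Variables (A V : Type).
Implicit Types (Gamma : rooted_graph A V) (p q : V).

(* The edge traversed when reading [x] from [p] to [q]: reading [a^-1]
   traverses an [a]-labeled edge backwards. *)
Definition traversed p (x : letter A) q : V * A * V :=
  if x.2 then (q, x.1, p) else (p, x.1, q).

Fixpoint path_labeled Gamma p (w : word A) q : Prop :=
  match w with
  | [::] => vertices Gamma p /\ p = q
  | x :: w' => vertices Gamma p /\
      exists2 r, edges Gamma (traversed p x r) & path_labeled Gamma r w' q
  end.

(* The subgraph spanned by the loops at the root labeled by elements of [W]:
   its vertices and edges are those occurring along these loops. *)
Definition spanned_by_loops Gamma (W : set (word A)) : rooted_graph A V := {|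
  vertices := [set p | exists u v, [/\ W (u ++ v),
    path_labeled Gamma (root Gamma) u p &
    path_labeled Gamma p v (root Gamma)]];
  root := root Gamma;
  edges := [set e | exists u x v p q, [/\ W (u ++ x :: v),
    path_labeled Gamma (root Gamma) u p,
    edges Gamma (traversed p x q),
    path_labeled Gamma q v (root Gamma) & e = traversed p x q]]
|}.

End Graphs.

Definition isomorphic (A V1 V2 : Type) (Gamma1 : rooted_graph A V1)
    (Gamma2 : rooted_graph A V2) : Prop :=
  exists f : V1 -> V2,
    [/\ set_bij (vertices Gamma1) (vertices Gamma2) f,
        f (root Gamma1) = root Gamma2
      & forall p a q, vertices Gamma1 p -> vertices Gamma1 q ->
          (edges Gamma1 (p, a, q) <-> edges Gamma2 (f p, a, f q))].

Definition rcoset (G : groupType) (H : set G) (g : G) : set G :=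
  [set (h * g)%g | h in H].

Definition schreier (A : finType) (G : groupType) (mu : word A -> G)
    (H : set G) : rooted_graph A (set G) := {|
  vertices := range (rcoset H);
  root := H;
  edges := [set e | exists g a,
    e = (rcoset H g, a, rcoset H (g * mu [:: (a, false)])%g)]
|}.

Definition stallings (A : finType) (G : groupType) (mu : word A -> G)
    (L : set (word A)) (H : set G) : rooted_graph A (set G) :=
  spanned_by_loops (schreier mu H) (L `&` mu @^-1` H).

(* Explicit finite rooted graphs, with vertex set {0, ..., n-1}. *)
Record finite_graph (A : Type) := FiniteGraph {
  nvertices : nat;
  froot : 'I_nvertices;
  fedges : seq ('I_nvertices * A * 'I_nvertices)
}.

Definition graph_of (A : finType) (Gamma : finite_graph A) :
    rooted_graph A 'I_(nvertices Gamma) :=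
  {| vertices := setT; root := froot Gamma; edges := [set` fedges Gamma] |}.

(** * Encoding of the inputs and outputs of algorithms by trees

   The letters of the alphabet are numbered by [enum_rank]. *)

Definition enc_seq (T : Type) (enc : T -> tree) (s : seq T) : tree :=
  foldr (fun x t => Node (enc x) t) Leaf s.

Definition enc_option (T : Type) (enc : T -> tree) (o : option T) : tree :=
  if o is Some x then Node (enc x) Leaf else Leaf.

Definition enc_pair (S T : Type) (encS : S -> tree) (encT : T -> tree)
    (x : S * T) : tree :=
  Node (encS x.1) (encT x.2).

Definition enc_ord (n : nat) (i : 'I_n) : tree := tnat i.

Definition enc_alpha (A : finType) (a : A) : tree := enc_ord (enum_rank a).

Definition enc_bool (b : bool) : tree := tnat b.

Definition enc_letter (A : finType) : letter A -> tree :=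
  enc_pair (@enc_alpha A) enc_bool.

Definition enc_word (A : finType) : word A -> tree := enc_seq (@enc_letter A).

Definition enc_edge (n : nat) (S : Type) (enc : S -> tree) :
    'I_n * S * 'I_n -> tree :=
  enc_pair (enc_pair (@enc_ord n) enc) (@enc_ord n).

Definition enc_automaton (S : Type) (enc : S -> tree) (M : automaton S) :
    tree :=
  Node (tnat (nstates M))
    (Node (enc_seq (@enc_ord _) (initial M))
      (Node (enc_seq (@enc_ord _) (final M))
        (enc_seq (enc_edge enc) (transitions M)))).

Definition enc_multiplier (A : finType) :
    automaton (option (letter A) * option (letter A)) -> tree :=
  enc_automaton
    (enc_pair (enc_option (@enc_letter A)) (enc_option (@enc_letter A))).

(* The size of the alphabet, the automaton of representatives, the multiplier
   of 1, and the list of the pairs of multipliers of [a] and [a^-1]. *)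
Definition enc_automata (A : finType) (D : automata A) : tree :=
  Node (tnat #|A|)
    (Node (enc_automaton (@enc_letter A) (representatives D))
      (Node (enc_multiplier (multiplier D None))
        (enc_seq (fun a : A =>
            Node (enc_multiplier (multiplier D (Some (a, false))))
                 (enc_multiplier (multiplier D (Some (a, true)))))
          (enum A)))).

Definition enc_input (A : finType) (D : automata A) (hs : seq (word A)) :
    tree :=
  Node (enc_automata D) (enc_seq (@enc_word A) hs).

Definition enc_graph (A : finType) (Gamma : finite_graph A) : tree :=
  Node (tnat (nvertices Gamma))
    (Node (enc_ord (froot Gamma))
      (enc_seq (enc_edge (@enc_alpha A)) (fedges Gamma))).

(* Main.v *)
Require Import Defs.
From HB Require Import structures.
From mathcomp Require Import all_boot.
From mathcomp Require Import boolp classical_sets functions.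

(** The algorithm enumerates finite certificates and stops at the first one that
   passes a decidable check. A certificate contains finite edge sets
   EG <= E0 <= E whose vertices are named by words, the vertex p standing for
   the coset H mu(p). Each edge (p, a, q) of E comes with an equality p a = z q
   in G, where z is a product of generators; the equality is witnessed by two
   paths of L-words whose consecutive words are accepted by the multipliers.
   Hence the loops of E at the root read elements of H.

   Say that p is complete for g if all the L-representatives of g lead from the
   root to p in E. The certificate contains inductive invariants of the
   multipliers run together with two copies of E; they show that, for an edge
   (p, x, q) of E0, p is complete for g iff q is complete for g x. The
   generators being loops of E0 at the root, the root is complete for all the
   elements of H. It follows that the vertices of E0 are distinct cosets, and
   EG is the Stallings graph as soon as the L-words of H are read in EG and each
   edge of EG occurs on one of them.

   Conversely, for a quasi-convex H let E0 and E be balls of the Schreier graph.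
   By the fellow traveller property, the second one can be taken so large that
   it contains the paths from the root labeled by the L-words of the cosets of
   the first one. *)

Set Implicit Arguments.
Unset Strict Implicit.
Unset Printing Implicit Defensive.

(** * Trees and computable functions *)

Fixpoint eqtree (s t : tree) : bool :=
  match s, t with
  | Leaf, Leaf => true
  | Node l r, Node l' r' => eqtree l l' && eqtree r r'
  | _, _ => false
  end.

Lemma eqtreeP : Equality.axiom eqtree.
Proof.
elim=> [|l IHl r IHr] [|l' r'] /=; try by constructor.
by apply: (iffP andP) => [[/IHl-> /IHr->]|[/IHl ? /IHr ?]].
Qed.

HB.instance Definition _ := hasDecEq.Build tree eqtreeP.

Definition isnode t : bool := if t is Node _ _ then true else false.

Fixpoint tlist (t : tree) : seq tree := if t is Node x s then x :: tlist s else [::].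

Definition ofseq (s : seq tree) : tree := foldr Node Leaf s.

Lemma tlistK : cancel tlist ofseq.
Proof. by elim=> //= l _ r ->. Qed.

Lemma ofseqK : cancel ofseq tlist.
Proof. by elim=> //= x s ->. Qed.

Lemma enc_seqE (T : Type) (enc : T -> tree) (s : seq T) :
  enc_seq enc s = ofseq (map enc s).
Proof. by elim: s => //= x s ->. Qed.

Lemma tlist_enc_seq (T : Type) (enc : T -> tree) (s : seq T) :
  tlist (enc_seq enc s) = map enc s.
Proof. by rewrite enc_seqE ofseqK. Qed.

Lemma tnat_inj : injective tnat.
Proof. by elim=> [|m IH] [|n] //= [/IH->]. Qed.

(** Totality is built in. A boolean is coded by [Leaf] or [tnat 1], so [isnode] decodes it; a list
    is coded by a right comb, and every tree codes a list because [ofseq] and [tlist] are mutually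
    inverse. *)
Definition computable (f : tree -> tree) := exists p, forall x, eval p x (f x).
Definition computable_bool (b : tree -> bool) := computable (fun x => tnat (b x)).
Definition computable_seq (s : tree -> seq tree) := computable (fun x => ofseq (s x)).

Lemma computable_id : computable (fun x => x).
Proof. by exists PId. Qed.

Lemma computable_leaf : computable (fun=> Leaf).
Proof. by exists PLeaf. Qed.

Lemma computable_comp f g :
  computable g -> computable f -> computable (fun x => g (f x)).
Proof. by move=> [p Hp] [q Hq]; exists (PComp p q) => x /=; exists (f x). Qed.

Lemma computable_fst f : computable f -> computable (fun x => tfst (f x)).
Proof. by apply: computable_comp; exists PFst. Qed.

Lemma computable_snd f : computable f -> computable (fun x => tsnd (f x)).
Proof. by apply: computable_comp; exists PSnd. Qed.

Lemma computable_node f g :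
  computable f -> computable g -> computable (fun x => Node (f x) (g x)).
Proof. by move=> [p Hp] [q Hq]; exists (PPair p q) => x /=; exists (f x), (g x). Qed.

(** Functional form of [rec_graph], with [e] as parameter. *)
Fixpoint trec (F : tree -> tree) (K : tree -> tree -> tree -> tree -> tree -> tree)
    (e t : tree) : tree :=
  if t is Node l r then K e l r (trec F K e l) (trec F K e r) else F e.

Lemma computable_rec F K f : computable F ->
  computable (fun y => K (tfst y) (tfst (tfst (tsnd y))) (tsnd (tfst (tsnd y)))
                         (tfst (tsnd (tsnd y))) (tsnd (tsnd (tsnd y)))) ->
  computable f -> computable (fun x => trec F K x (f x)).
Proof.
move=> [p Hp] [q Hq] [r Hr]; exists (PComp (PRec p q) (PPair PId r)) => x /=.
exists (Node x (f x)) => /=; first by exists x, (f x).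
elim: (f x) => [|a IHa b IHb] //=.
by exists (trec F K x a), (trec F K x b); split=> //; apply: Hq.
Qed.

Lemma computable_cst t : computable (fun=> t).
Proof.
by elim: t => [|l IHl r IHr]; [exact: computable_leaf | exact: computable_node].
Qed.

(** A conditional is a recursion along [tnat (b x)]: the [Leaf] case returns [g], the node case
    returns [f] and ignores the recursive results. *)
Lemma computable_if b f g : computable_bool b -> computable f -> computable g ->
  computable (fun x => if b x then f x else g x).
Proof.
move=> Hb Hf Hg.
have -> : (fun x => if b x then f x else g x) =
  (fun x => trec g (fun e _ _ _ _ => f e) x (tnat (b x))).
  by apply: funext => x; case: (b x).
apply: computable_rec => //; apply: (computable_comp Hf).
exact: (computable_fst computable_id).
Qed.

(** A right fold is a recursion along the comb [ofseq (s x)] that ignores the result on left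
    subtrees. *)
Lemma computable_foldr (g : tree -> tree -> tree -> tree) z s :
  computable_seq s -> computable z ->
  computable (fun y => g (tfst y) (tfst (tsnd y)) (tsnd (tsnd y))) ->
  computable (fun x => foldr (g x) (z x) (s x)).
Proof.
move=> Hs Hz Hg.
have -> : (fun x => foldr (g x) (z x) (s x)) =
  (fun x => trec z (fun e l _ _ vr => g e l vr) x (ofseq (s x))).
  by apply: funext => x; elim: (s x) => //= a l ->.
apply: computable_rec => //.
pose h y := Node (tfst y) (Node (tfst (tfst (tsnd y))) (tsnd (tsnd (tsnd y)))).
have /= := computable_comp Hg (f := h); apply.
by repeat first [exact: computable_id | apply: computable_node
  | apply: computable_fst | apply: computable_snd].
Qed.

(** * Computable booleans and lists *)

Lemma computable_bool_cst b : computable_bool (fun=> b).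
Proof. exact: computable_cst. Qed.

Lemma computable_seq_tlist f : computable f -> computable_seq (fun x => tlist (f x)).
Proof. by rewrite /computable_seq; under [X in _ -> computable X]funext do rewrite tlistK. Qed.

Lemma computable_bool_if b f g :
  computable_bool b -> computable_bool f -> computable_bool g ->
  computable_bool (fun x => if b x then f x else g x).
Proof.
move=> Hb Hf Hg; rewrite /computable_bool.
have -> : (fun x => tnat (if b x then f x else g x)) =
  (fun x => if b x then tnat (f x) else tnat (g x)).
  by apply: funext => x; case: (b x).
exact: computable_if.
Qed.

Lemma computable_seq_if b f g :
  computable_bool b -> computable_seq f -> computable_seq g ->
  computable_seq (fun x => if b x then f x else g x).
Proof.
move=> Hb Hf Hg; rewrite /computable_seq.
have -> : (fun x => ofseq (if b x then f x else g x)) =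
  (fun x => if b x then ofseq (f x) else ofseq (g x)).
  by apply: funext => x; case: (b x).
exact: computable_if.
Qed.

Lemma computable_and b c : computable_bool b -> computable_bool c ->
  computable_bool (fun x => b x && c x).
Proof. by move=> Hb Hc; apply: computable_bool_if => //; apply: computable_bool_cst. Qed.

Lemma computable_or b c : computable_bool b -> computable_bool c ->
  computable_bool (fun x => b x || c x).
Proof. by move=> Hb Hc; apply: computable_bool_if => //; apply: computable_bool_cst. Qed.

Lemma computable_neg b : computable_bool b -> computable_bool (fun x => ~~ b x).
Proof. by move=> Hb; apply: computable_bool_if => //; apply: computable_bool_cst. Qed.

Lemma computable_imply b c : computable_bool b -> computable_bool c ->
  computable_bool (fun x => b x ==> c x).
Proof. by move=> Hb Hc; apply: computable_bool_if => //; apply: computable_bool_cst. Qed.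

Lemma computable_isnode f : computable f -> computable_bool (fun x => isnode (f x)).
Proof.
move=> Hf; rewrite /computable_bool.
have -> : (fun x => tnat (isnode (f x))) =
  (fun x => trec (fun=> Leaf) (fun _ _ _ _ _ => tnat 1) x (f x)).
  by apply: funext => x; case: (f x).
by apply: computable_rec => //; apply: computable_cst.
Qed.

Lemma computable_ofseq s : computable_seq s -> computable (fun x => ofseq (s x)).
Proof. by []. Qed.

Lemma computable_nil : computable_seq (fun=> [::]).
Proof. exact: computable_leaf. Qed.

Lemma computable_cons f s : computable f -> computable_seq s ->
  computable_seq (fun x => f x :: s x).
Proof. exact: computable_node. Qed.

Lemma computable_seq_foldr (g : tree -> tree -> seq tree -> seq tree) z s :
  computable_seq s -> computable_seq z ->
  computable_seq (fun y => g (tfst y) (tfst (tsnd y)) (tlist (tsnd (tsnd y)))) ->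
  computable_seq (fun x => foldr (g x) (z x) (s x)).
Proof.
move=> Hs Hz Hg; rewrite /computable_seq.
have -> : (fun x => ofseq (foldr (g x) (z x) (s x))) =
  (fun x => foldr (fun y a => ofseq (g x y (tlist a))) (ofseq (z x)) (s x)).
  by apply: funext => x; elim: (s x) => //= a l <-; rewrite ofseqK.
exact: (@computable_foldr (fun x y a => ofseq (g x y (tlist a)))).
Qed.

Lemma computable_bool_foldr (g : tree -> tree -> bool -> bool) z s :
  computable_seq s -> computable_bool z ->
  computable_bool (fun y => g (tfst y) (tfst (tsnd y)) (isnode (tsnd (tsnd y)))) ->
  computable_bool (fun x => foldr (g x) (z x) (s x)).
Proof.
move=> Hs Hz Hg; rewrite /computable_bool.
have -> : (fun x => tnat (foldr (g x) (z x) (s x))) =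
  (fun x => foldr (fun y a => tnat (g x y (isnode a))) (tnat (z x)) (s x)).
  apply: funext => x; elim: (s x) => //= a l <-.
  by case: (foldr _ _ l).
exact: (@computable_foldr (fun x y a => tnat (g x y (isnode a)))).
Qed.

Lemma computable_cat s t : computable_seq s -> computable_seq t ->
  computable_seq (fun x => s x ++ t x).
Proof.
move=> Hs Ht.
have -> : (fun x => s x ++ t x) = (fun x => foldr cons (t x) (s x)).
  by apply: funext => x; elim: (s x) => //= a l ->.
apply: (@computable_seq_foldr (fun _ => cons)) => //.
apply: computable_cons; last apply: computable_seq_tlist;
by repeat first [exact: computable_id | apply: computable_fst | apply: computable_snd].
Qed.

Ltac computable_step :=
  cbv beta;
  match goal with
  | |- computable _ =>
    first [ exact: computable_id | exact: computable_cst
      | apply: computable_fst | apply: computable_snd | apply: computable_node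
      | apply: computable_ofseq ]
  | |- computable_seq _ =>
    first [ exact: computable_nil | apply: computable_seq_tlist
      | apply: computable_cons | apply: computable_cat ]
  | |- computable_bool _ =>
    first [ exact: computable_bool_cst | apply: computable_isnode
      | apply: computable_and | apply: computable_or | apply: computable_neg
      | apply: computable_imply ]
  end.

Lemma computable_map (f : tree -> tree -> tree) s :
  computable_seq s -> computable (fun y => f (tfst y) (tsnd y)) ->
  computable_seq (fun x => map (f x) (s x)).
Proof.
move=> Hs Hf.
have -> : (fun x => map (f x) (s x)) =
    (fun x => foldr (fun y a => f x y :: a) [::] (s x)).
  by apply: funext => x; elim: (s x) => //= a l ->.
apply: (@computable_seq_foldr (fun x y a => f x y :: a)) => //; first exact: computable_nil.
apply: computable_cons; last by repeat computable_step.
have /= := computable_comp Hf (f := fun y => Node (tfst y) (tfst (tsnd y))).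
by apply; repeat computable_step.
Qed.

Lemma computable_flatmap (f : tree -> tree -> seq tree) s :
  computable_seq s -> computable_seq (fun y => f (tfst y) (tsnd y)) ->
  computable_seq (fun x => flatten (map (f x) (s x))).
Proof.
move=> Hs Hf.
have -> : (fun x => flatten (map (f x) (s x))) =
    (fun x => foldr (fun y a => f x y ++ a) [::] (s x)).
  by apply: funext => x; elim: (s x) => //= a l ->.
apply: (@computable_seq_foldr (fun x y a => f x y ++ a)) => //; first exact: computable_nil.
apply: computable_cat; last by repeat computable_step.
have /= := computable_comp Hf (f := fun y => Node (tfst y) (tfst (tsnd y))).
by apply; repeat computable_step.
Qed.

Lemma computable_filter (f : tree -> tree -> bool) s :
  computable_seq s -> computable_bool (fun y => f (tfst y) (tsnd y)) ->
  computable_seq (fun x => filter (f x) (s x)).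
Proof.
move=> Hs Hf.
have -> : (fun x => filter (f x) (s x)) =
    (fun x => foldr (fun y a => if f x y then y :: a else a) [::] (s x)).
  by apply: funext => x; elim: (s x) => //= a l ->.
apply: (@computable_seq_foldr (fun x y a => if f x y then y :: a else a)) => //.
  exact: computable_nil.
apply: computable_seq_if; try by repeat computable_step.
have /= := computable_comp Hf (f := fun y => Node (tfst y) (tfst (tsnd y))).
by apply; repeat computable_step.
Qed.

Lemma computable_all (f : tree -> tree -> bool) s :
  computable_seq s -> computable_bool (fun y => f (tfst y) (tsnd y)) ->
  computable_bool (fun x => all (f x) (s x)).
Proof.
move=> Hs Hf.
have -> : (fun x => all (f x) (s x)) =
    (fun x => foldr (fun y a => f x y && a) true (s x)).
  by apply: funext => x; elim: (s x) => //= a l ->.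
apply: (@computable_bool_foldr (fun x y a => f x y && a)) => //.
  exact: computable_bool_cst.
apply: computable_and; last by repeat computable_step.
have /= := computable_comp Hf (f := fun y => Node (tfst y) (tfst (tsnd y))).
by apply; repeat computable_step.
Qed.

Lemma computable_has (f : tree -> tree -> bool) s :
  computable_seq s -> computable_bool (fun y => f (tfst y) (tsnd y)) ->
  computable_bool (fun x => has (f x) (s x)).
Proof.
move=> Hs Hf.
have -> : (fun x => has (f x) (s x)) = (fun x => ~~ all (fun y => ~~ f x y) (s x)).
  by apply: funext => x; rewrite -[has _ _]negbK -all_predC.
apply: computable_neg; apply: (@computable_all (fun x y => ~~ f x y)) => //.
exact: computable_neg.
Qed.

Lemma computable_rev s : computable_seq s -> computable_seq (fun x => rev (s x)).
Proof.
move=> Hs.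
have -> : (fun x => rev (s x)) = (fun x => foldr (fun y a => a ++ [:: y]) [::] (s x)).
  by apply: funext => x; elim: (s x) => //= a l <-; rewrite rev_cons cats1.
by apply: (@computable_seq_foldr (fun _ y a => a ++ [:: y])) => //; repeat computable_step.
Qed.

Lemma computable_foldl (g : tree -> seq tree -> tree -> seq tree) z s :
  computable_seq s -> computable_seq z ->
  computable_seq (fun y => g (tfst y) (tlist (tsnd (tsnd y))) (tfst (tsnd y))) ->
  computable_seq (fun x => foldl (g x) (z x) (s x)).
Proof.
move=> Hs Hz Hg.
have -> : (fun x => foldl (g x) (z x) (s x)) =
    (fun x => foldr (fun y a => g x a y) (z x) (rev (s x))).
  by apply: funext => x; rewrite -foldl_rev revK.
by apply: (@computable_seq_foldr (fun x y a => g x a y)) => //; apply: computable_rev.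
Qed.

(* Equality of trees is decided by matching a stack of trees against the
   prefix notation of the other tree; the stack is [None] after a failure. *)
Fixpoint prefix_notation (t : tree) : seq tree :=
  if t is Node l r then tnat 1 :: prefix_notation l ++ prefix_notation r
  else [:: Leaf].

Definition match_token (o tok : tree) : tree :=
  if isnode o then
    if isnode (tfst o) then
      if isnode tok then
        if isnode (tfst (tfst o)) then
          Node (Node (tfst (tfst (tfst o)))
                 (Node (tsnd (tfst (tfst o))) (tsnd (tfst o)))) Leaf
        else Leaf
      else if isnode (tfst (tfst o)) then Leaf else Node (tsnd (tfst o)) Leaf
    else Leaf
  else Leaf.

(** A node token replaces the top of the stack by its two children, a leaf token pops a leaf, and
    failure is absorbing. The induction on [s] needs an arbitrary stack below [t]. *)
Lemma match_prefix_notation s t st :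
  foldl match_token (Node (Node t st) Leaf) (prefix_notation s) =
  if s == t then Node st Leaf else Leaf.
Proof.
have fail l : foldl match_token Leaf l = Leaf by elim: l.
elim: s t st => [|l IHl r IHr] [|l' r'] st //=.
rewrite {2}/match_token /= foldl_cat IHl; have -> : (Node l r == Node l' r') = (l == l') && (r == r') by [].
by case: eqP => /= _; rewrite ?IHr ?fail.
Qed.

Lemma computable_eq f g : computable f -> computable g ->
  computable_bool (fun x => f x == g x).
Proof.
move=> Hf Hg.
have -> : (fun x => f x == g x) = (fun x => isnode
   (foldr (fun tok o => match_token o tok) (Node (Node (g x) Leaf) Leaf)
     (rev (prefix_notation (f x))))).
  apply: funext => x; rewrite -foldl_rev revK match_prefix_notation.
  by case: (f x == g x).
apply: computable_isnode; apply: (@computable_foldr (fun _ tok o => match_token o tok)).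
- apply: computable_rev; rewrite /computable_seq.
  have -> : (fun x => ofseq (prefix_notation (f x))) =
     (fun x => trec (fun=> ofseq [:: Leaf])
       (fun _ _ _ a b => ofseq (tnat 1 :: tlist a ++ tlist b)) x (f x)).
    apply: funext => x; elim: (f x) => //= a IHa b IHb.
    by rewrite -IHa -IHb !ofseqK.
  by apply: computable_rec => //; last (rewrite -/(computable_seq _); cbv beta);
    repeat computable_step.
- by repeat computable_step.
- by rewrite /match_token; repeat first [apply: computable_if | computable_step].
Qed.

Lemma computable_mem f s : computable f -> computable_seq s ->
  computable_bool (fun x => f x \in s x).
Proof.
move=> Hf Hs.
have -> : (fun x => f x \in s x) = (fun x => has (fun y => y == f x) (s x)).
  by apply: funext => x; rewrite -has_pred1; apply: eq_has.
apply: (@computable_has (fun x y => y == f x)) => //.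
apply: computable_eq; first by repeat computable_step.
by apply: computable_comp => //; repeat computable_step.
Qed.

Lemma computable_size s : computable_seq s -> computable (fun x => tnat (size (s x))).
Proof.
move=> Hs.
have -> : (fun x => tnat (size (s x))) = (fun x => foldr (fun _ a => Node Leaf a) Leaf (s x)).
  by apply: funext => x; elim: (s x) => //= a l <-.
by apply: (@computable_foldr (fun _ _ a => Node Leaf a)) => //; repeat computable_step.
Qed.

Lemma computable_index f s : computable f -> computable_seq s ->
  computable (fun x => tnat (index (f x) (s x))).
Proof.
move=> Hf Hs.
have -> : (fun x => tnat (index (f x) (s x))) =
   (fun x => foldr (fun y a => if y == f x then Leaf else Node Leaf a) Leaf (s x)).
  by apply: funext => x; elim: (s x) => //= a l <-; case: eqP.
apply: (@computable_foldr (fun x y a => if y == f x then Leaf else Node Leaf a)) => //;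
  first exact: computable_leaf.
apply: computable_if; try apply: computable_eq; try by repeat computable_step.
by apply: computable_comp => //; repeat computable_step.
Qed.

Lemma computable_undup s : computable_seq s -> computable_seq (fun x => undup (s x)).
Proof.
move=> Hs.
have -> : (fun x => undup (s x)) =
   (fun x => foldr (fun y a => if y \in a then a else y :: a) [::] (s x)).
  apply: funext => x; elim: (s x) => //= a l <-.
  by rewrite mem_undup.
apply: (@computable_seq_foldr (fun x y a => if y \in a then a else y :: a)) => //;
  first exact: computable_nil.
by apply: computable_seq_if; try apply: computable_mem; repeat computable_step.
Qed.

(** * Automated proofs of computability *)

Ltac computable_hook := fail.

Ltac computable_env :=
  match goal with
  | H : computable ?f |- computable (fun y => ?f (@?g y)) =>
      apply: (computable_comp (f := g) H)
  | H : computable_seq ?s |- computable_seq (fun y => ?s (@?g y)) =>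
      apply: (computable_comp (f := g) H)
  end.

(** The hook is redefined after each batch of functions has been proved computable, so that later
    goals stop at these functions instead of unfolding them. *)
Ltac computable_tac :=
  repeat (cbv beta; first [ exact: computable_id | computable_env | computable_step
    | computable_hook |
  match goal with
  | |- computable (fun y => tnat (nat_of_bool (@?b y))) => change (computable_bool b)
  | |- computable _ =>
    first [ apply: computable_size | apply: computable_index | apply: computable_if ]
  | |- computable_seq _ =>
    first [ apply: computable_map | apply: computable_flatmap
      | apply: computable_filter | apply: computable_foldl | apply: computable_rev
      | apply: computable_undup | apply: computable_seq_if | apply: computable_seq_foldr ]
  | |- computable_bool _ =>
    first [ apply: computable_eq | apply: computable_mem
      | apply: computable_all | apply: computable_has ]
  end ]).

(** * Unbounded search *)

(** Iterated [n] times from the empty list, it lists the trees of height less than [n]. *)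
Definition trees_step (s : seq tree) : seq tree :=
  Leaf :: flatten [seq [seq Node a b | b <- s] | a <- s].

Definition trees (n : nat) : seq tree := iter n trees_step [::].

Lemma trees_exhaustive t : exists n, t \in trees n.
Proof.
(* The stages increase, so the two subtrees of a node, found at different stages, are both present
   at the larger one. *)
have step m u : u \in trees m -> u \in trees m.+1.
  elim: m u => [//|m IHm] u; rewrite inE => /orP[/eqP->|]; first by rewrite inE eqxx.
  move=> /flatten_mapP[a am /mapP[b bm ->]].
  rewrite inE; apply/orP; right; apply/flatten_mapP; exists a; first exact: IHm.
  by apply: map_f; apply: IHm.
have mono n m u : n <= m -> u \in trees n -> u \in trees m.
  by move=> /subnK <-; elim: (m - n) => // k IHk /IHk; apply: step.
elim: t => [|l [m Hm] r [n Hn]]; first by exists 1.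
exists (maxn m n).+1; rewrite /= inE; apply/orP; right; apply/flatten_mapP.
exists l; first exact: mono (leq_maxl _ _) Hm.
by apply: map_f; apply: mono (leq_maxr _ _) Hn.
Qed.

(** The stage is passed as the length of a list: each node on the spine of the comb applies
    [trees_step] once. *)
Lemma computable_trees f : computable f ->
  computable_seq (fun x => trees (size (tlist (f x)))).
Proof.
move=> Hf; rewrite /computable_seq.
have -> : (fun x => ofseq (trees (size (tlist (f x))))) =
   (fun x => trec (fun=> Leaf) (fun _ _ _ _ a => ofseq (trees_step (tlist a))) x (f x)).
  by apply: funext => x; elim: (f x) => //= l _ r <-; rewrite ofseqK.
by apply: computable_rec => //; last (rewrite -/(computable_seq _) /trees_step; cbv beta);
  computable_tac.
Qed.

(** Minimisation finds the least stage at which some listed tree passes the check; the program then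
    filters that stage again and applies [out] to the first survivor, which may differ from the
    given [c]. *)
Lemma computable_search (chk : tree -> tree -> bool) (out : tree -> tree -> tree) :
  computable_bool (fun y => chk (tfst y) (tsnd y)) ->
  computable (fun y => out (tfst y) (tsnd y)) ->
  exists P, forall x,
    (forall c, chk x c -> exists2 c', chk x c' & eval P x (out x c')) /\
    ((forall c, ~~ chk x c) -> ~ halts P x).
Proof.
move=> Hchk Hout.
have Hchk' f g : computable f -> computable g ->
    computable_bool (fun y => chk (f y) (g y)).
  move=> Hf Hg; have /= := computable_comp Hchk (f := fun y => Node (f y) (g y)).
  by apply; apply: computable_node.
have [pf Hpf] : computable_bool (fun y => has (chk (tfst y)) (trees (size (tlist (tsnd y))))).
  apply: (@computable_has (fun y => chk (tfst y))).
    by apply: computable_trees; repeat computable_step.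
  by apply: Hchk'; repeat computable_step.
have [po Hpo] : computable (fun y => out (tfst y)
    (tfst (ofseq (filter (chk (tfst y)) (trees (size (tlist (tsnd y)))))))).
  have /= := computable_comp Hout (f := fun y => Node (tfst y)
    (tfst (ofseq (filter (chk (tfst y)) (trees (size (tlist (tsnd y)))))))).
  apply; apply: computable_node; first by repeat computable_step.
  apply: computable_fst; apply: (@computable_filter (fun y => chk (tfst y))).
    by apply: computable_trees; repeat computable_step.
  by apply: Hchk'; repeat computable_step.
(* The counter of [PMu], read as a list of leaves, has the stage as its length. *)
have tnatK n : size (tlist (tnat n)) = n by elim: n => //= n ->.
exists (PComp po (PPair PId (PMu pf))) => x; split=> [c xc|no_c].
  have [|n Hn least_n] := @ex_minnP (fun n => has (chk x) (trees n)).
    by have [n cn] := trees_exhaustive c; exists n; apply/hasP; exists c.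
  exists (tfst (ofseq (filter (chk x) (trees n)))).
    move: Hn; rewrite has_filter; case E: (filter _ _) => [//|d s] _ /=.
    by have := mem_head d s; rewrite -E mem_filter => /andP[].
  exists (Node x (tnat n)); last by have := Hpo (Node x (tnat n)); rewrite /= tnatK.
  exists x, (tnat n); split=> //; exists n; split=> //.
    exists (tnat 1) => //; have := Hpf (Node x (tnat n)); rewrite /= tnatK.
    by rewrite Hn.
  move=> m lt_mn; have := Hpf (Node x (tnat m)); rewrite /= tnatK.
  case Hm: (has _ _) => //.
  by have := least_n m Hm; rewrite leqNgt lt_mn.
(* A halting run would contain a stage at which [pf] does not return [Leaf], although no listed tree
   passes the check. *)
move=> [y [z [y1 [y2 [_ [n [_ [v Hv nv] _]] _]] _]]].
case: nv; apply: eval_det Hv _; have := Hpf (Node x (tnat n)); rewrite /= tnatK.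
by have /hasPn/negbTE-> : {in trees n, forall c, ~~ chk x c} by move=> c _.
Qed.

(** * Edge lists and reachability *)

(** The layout of [enc_edge], shared by transitions of automata, edges of graphs and edges between
    [L]-words. *)
Definition src (e : tree) : tree := tfst (tfst e).
Definition lab (e : tree) : tree := tsnd (tfst e).
Definition tgt (e : tree) : tree := tsnd e.

(** One step of the subset construction. The result is a list ordered as in [T], possibly with
    repetitions, so it is determined by a sublist of [T]. *)
Definition nstep (T S : seq tree) (x : tree) : seq tree :=
  [seq tgt t | t <- [seq t <- T | (src t \in S) && (lab t == x)]].

Definition reach (T S w : seq tree) : seq tree := foldl (nstep T) S w.

Lemma nstepP T S x q :
  reflect (exists t, [/\ t \in T, src t \in S, lab t = x & tgt t = q]) (q \in nstep T S x).
Proof.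
apply: (iffP mapP) => [[t]|[t [tT tS tx tq]]].
  by rewrite mem_filter => /andP[/andP[tS /eqP tx] tT] ->; exists t.
by exists t; rewrite ?mem_filter ?tS ?tx ?eqxx.
Qed.

Lemma reach_rcons T S w x : reach T S (rcons w x) = nstep T (reach T S w) x.
Proof. exact: foldl_rcons. Qed.

Lemma reach_cat T S w w' : reach T S (w ++ w') = reach T (reach T S w) w'.
Proof. exact: foldl_cat. Qed.

Lemma reach_mono T T' S S' w : {subset T <= T'} -> {subset S <= S'} ->
  {subset reach T S w <= reach T' S' w}.
Proof.
move=> sT; elim: w S S' => //= x w IH S S' sS; apply: IH => q.
by move=> /nstepP[t [tT tS tx tq]]; apply/nstepP; exists t; split=> //; auto.
Qed.

Lemma reach1 T S w q : q \in reach T S w -> exists2 p, p \in S & q \in reach T [:: p] w.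
Proof.
elim/last_ind: w q => [|w x IH] q; first by move=> qS; exists q; rewrite ?inE.
rewrite reach_rcons => /nstepP[t [tT /IH[p pS tp] tx tq]].
by exists p => //; rewrite reach_rcons; apply/nstepP; exists t.
Qed.

Lemma reach_split T S u v r : r \in reach T S (u ++ v) ->
  exists2 q, q \in reach T S u & r \in reach T [:: q] v.
Proof. by rewrite reach_cat => /reach1. Qed.

Lemma reach_join T S u v q r :
  q \in reach T S u -> r \in reach T [:: q] v -> r \in reach T S (u ++ v).
Proof.
move=> qu; rewrite reach_cat; apply: reach_mono => // p.
by rewrite inE => /eqP->.
Qed.

Lemma reach_edge T t : t \in T -> tgt t \in reach T [:: src t] [:: lab t].
Proof. by move=> tT; apply/nstepP; exists t; rewrite inE. Qed.

Definition deterministic (T : seq tree) : bool :=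
  all (fun t => all (fun t' => (src t == src t') && (lab t == lab t') ==> (tgt t == tgt t')) T) T.

Lemma reach_det T p w q q' : deterministic T ->
  q \in reach T [:: p] w -> q' \in reach T [:: p] w -> q = q'.
Proof.
move=> detT; elim/last_ind: w q q' => [|w x IH] q q'.
  by rewrite !inE => /eqP-> /eqP->.
rewrite reach_rcons => /nstepP[t [tT tw tx <-]] /nstepP[t' [t'T t'w t'x <-]].
have /allP/(_ _ t'T)/implyP := allP detT t tT.
by rewrite (IH _ _ tw t'w) tx t'x !eqxx => /(_ isT)/eqP.
Qed.

(** * Automata *)

Definition aut_initial (M : tree) : seq tree := tlist (tfst (tsnd M)).
Definition aut_final (M : tree) : seq tree := tlist (tfst (tsnd (tsnd M))).
Definition aut_trans (M : tree) : seq tree := tlist (tsnd (tsnd (tsnd M))).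

Definition accepts (M : tree) (w : seq tree) : bool :=
  has (fun p => p \in aut_final M) (reach (aut_trans M) (aut_initial M) w).

Lemma run_rcons (S : eqType) (M : automaton S) p w x q :
  run p (rcons w x) q <-> exists2 r, run p w r & (r, x, q) \in transitions M.
Proof.
elim: w p => [|y w IH] p /=.
  by split=> [[r ? <-]|[r -> ?]]; [exists p | exists q].
split=> [[r pr /IH[r' ? ?]]|[r' [r pr ?] ?]]; first by exists r' => //; exists r.
by exists r => //; apply/IH; exists r'.
Qed.

Section EncodedAutomata.
Variables (S : eqType) (enc : S -> tree) (M : automaton S).
Let E := enc_automaton enc M.

Lemma aut_initialE : aut_initial E = map (@enc_ord _) (initial M).
Proof. exact: tlist_enc_seq. Qed.

Lemma aut_finalE : aut_final E = map (@enc_ord _) (final M).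
Proof. exact: tlist_enc_seq. Qed.

Lemma aut_transE : aut_trans E = map (enc_edge enc) (transitions M).
Proof. exact: tlist_enc_seq. Qed.

Lemma enc_ord_inj n : injective (@enc_ord n).
Proof. by move=> i j /tnat_inj /val_inj. Qed.

(** The word [w] is not assumed to be a code: each transition followed by the subset construction
    supplies the letter that its entry encodes. *)
Lemma reach_automatonP w q :
  q \in reach (aut_trans E) (aut_initial E) w <->
  exists w' p0 q', [/\ w = map enc w', q = enc_ord q', p0 \in initial M & run p0 w' q'].
Proof.
elim/last_ind: w q => [|w x IH] q.
  rewrite aut_initialE; split=> [/mapP[p pI ->]|[w' [p [q' [+ -> pI]]]]].
    by exists [::], p, p.
  by case: w' => //= _ <-; apply: map_f.
rewrite reach_rcons; split=> [/nstepP[t [tT tw tx tq]]|].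
  have [w' [p0 [r [-> tr p0I Hrun]]]] := (IH _).1 tw.
  move: tT; rewrite aut_transE => /mapP[[[r' y] q'] rT tE].
  move: tr tx tq; rewrite tE /= /src /lab /tgt /= => /enc_ord_inj r'E <- <-.
  exists (rcons w' y), p0, q'; rewrite map_rcons; split=> //.
  by apply/run_rcons; exists r => //; rewrite -r'E.
move=> [w' [p0 [q' [+ -> p0I]]]]; case/lastP: w' => [|w' y]; first by case: w {IH}.
rewrite map_rcons => /rcons_inj[wE ->] /run_rcons[r Hrun rT].
apply/nstepP; exists (enc_edge enc (r, y, q')); split=> //.
  by rewrite aut_transE map_f.
by apply/IH; exists w', p0, r.
Qed.

Lemma acceptsP w : accepts E w <-> exists2 w', w = map enc w' & accepted M w'.
Proof.
split=> [/hasP[q /reach_automatonP[w' [p0 [q' [-> -> p0I Hrun]]]]]|].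
  rewrite aut_finalE => /mapP[q'' qF /enc_ord_inj q'E].
  by exists w' => //; exists p0, q'; split=> //; rewrite q'E.
move=> [w' -> [p [q [pI qF Hrun]]]]; apply/hasP; exists (enc_ord q).
  by apply/reach_automatonP; exists w', p, q.
by rewrite aut_finalE map_f.
Qed.

End EncodedAutomata.

Lemma run_cat (Q : eqType) (M : automaton Q) p u v q :
  run p (u ++ v) q <-> exists2 r : 'I_(nstates M), run p u r & run r v q.
Proof.
elim: u p => [|y u IH] p /=; first by split=> [|[r ->]] //; exists p.
split=> [[s ps /IH[r ? ?]]|[r [s ps ?] ?]]; first by exists r => //; exists s.
by exists s => //; apply/IH; exists r.
Qed.

(** There are finitely many states; for each one that leads to a final state, fix the length of one
    such word, and take the maximum. *)
Lemma bounded_completion (Q : eqType) (M : automaton Q) : exists n,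
  forall (p q : 'I_(nstates M)) z, q \in final M -> run p z q ->
  exists z' q', [/\ size z' <= n, q' \in final M & run p z' q'].
Proof.
have [f fP] : exists f : 'I_(nstates M) -> nat, forall p q z, q \in final M -> run p z q ->
    exists z' q', [/\ size z' <= f p, q' \in final M & run p z' q'].
  apply: (fin_all_exists (P := fun p n => forall q z, q \in final M -> run p z q ->
    exists z' q', [/\ size z' <= n, q' \in final M & run p z' q'])) => p.
  (* For a state without any path to a final state the claim is vacuous, and 0 is as good as any
     bound. *)
  have [[q [z [qF pzq]]]|no] := pselect (exists q z, q \in final M /\ run p z q).
    by exists (size z) => _ _ _ _; exists z, q.
  by exists 0 => q z qF pzq; case: no; exists q, z.
exists (\max_p f p) => p q z qF /(fP _ _ _ qF)[z' [q' [z'p q'F pz'q']]].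
by exists z', q'; split=> //; apply: leq_trans z'p (leq_bigmax p).
Qed.

(** * Padded pairs of words *)

Definition proj (k : tree -> tree) (z : seq tree) : seq tree :=
  [seq tfst (k o) | o <- [seq o <- z | isnode (k o)]].

Definition enc_optpair (A : finType) : option (letter A) * option (letter A) -> tree :=
  enc_pair (enc_option (@enc_letter A)) (enc_option (@enc_letter A)).

Lemma pmap_onth_take (Q : Type) (s : seq Q) n :
  pmap id [seq onth s i | i <- iota 0 n] = take n s.
Proof.
elim: s n => [|y s IH] n /=; first by elim: (iota 0 n) => //= i l IH; case: i.
by case: n => //= n; rewrite -[1]addn0 iotaDl -map_comp IH.
Qed.

(** Cutting the padded pair at column [i] cuts both words at [i], also beyond the end of the shorter
    one. This is what compares prefixes of equal length of two words read by a multiplier. *)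
Lemma pmap_take_pad (Q : Type) (u v : seq Q) i :
  pmap fst (take i (pad u v)) = take i u /\ pmap snd (take i (pad u v)) = take i v.
Proof.
set m := maxn (size u) (size v).
have E (s : seq Q) : size s <= m -> take i s = take (minn i m) s.
  move=> sm; case: (leqP i m) => [//|mi].
  by rewrite !take_oversize // (leq_trans sm) // ltnW.
rewrite /pad -map_take take_iota (E u) ?leq_maxl // (E v) ?leq_maxr // -!pmap_onth_take.
by split; elim: (iota _ _) => //= j l ->.
Qed.

Lemma pmap_pad (Q : Type) (u v : seq Q) :
  pmap fst (pad u v) = u /\ pmap snd (pad u v) = v.
Proof.
have := pmap_take_pad u v (maxn (size u) (size v)).
by rewrite !take_oversize ?leq_maxl ?leq_maxr // /pad size_map size_iota.
Qed.

Lemma proj1_enc (A : finType) z :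
  proj tfst (map (@enc_optpair A) z) = map (@enc_letter A) (pmap fst z).
Proof. by rewrite /proj; elim: z => //= [[[x|] o] z] /= ->. Qed.

Lemma proj2_enc (A : finType) z :
  proj tsnd (map (@enc_optpair A) z) = map (@enc_letter A) (pmap snd z).
Proof. by rewrite /proj; elim: z => //= [[o [x|]] z] /= ->. Qed.

(** * The certificate checker *)

(* [e] is an edge labeled by a letter of [A]; the two entries read it in both
   directions. *)
Definition both1 (e : tree) : seq tree :=
  [:: Node (Node (src e) (Node (lab e) (tnat 0))) (tgt e);
      Node (Node (tgt e) (Node (lab e) (tnat 1))) (src e)].

Definition both (E : seq tree) : seq tree := flatten [seq both1 e | e <- E].

(** The padding symbol, coded by [Leaf], moves nothing. *)
Definition ostep (T S : seq tree) (o : tree) : seq tree :=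
  if isnode o then nstep T S (tfst o) else S.

(** Column by column form, so that each word of the pair advances in step with the multiplier. *)
Lemma reach_proj T S k z :
  reach T S (proj k z) = foldl (fun S o => ostep T S (k o)) S z.
Proof.
elim: z S => //= o z IH S; rewrite /proj /ostep /=.
by case: (isnode (k o)); rewrite /= -/(proj k z) IH.
Qed.

Definition state1 (i : tree) : seq tree := tlist (tfst (tsnd i)).
Definition state2 (i : tree) : seq tree := tlist (tsnd (tsnd i)).
Definition triple (m : tree) (S1 S2 : seq tree) : tree :=
  Node m (Node (ofseq S1) (ofseq S2)).

(* [I] contains all the triples (state of the automaton [M], vertices reached
   by the first word in [Ta], vertices reached by the second word in [Tb])
   that occur while [M] reads a pair of words. *)
Definition invariant (M : tree) (Ta Tb I : seq tree) : bool :=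
  all (fun m => triple m [:: Leaf] [:: Leaf] \in I) (aut_initial M) &&
  all (fun i => all (fun t => (src t == tfst i) ==>
    (triple (tgt t) (ostep Ta (state1 i) (tfst (lab t)))
                    (ostep Tb (state2 i) (tsnd (lab t))) \in I))
      (aut_trans M)) I.

Lemma invariantP M Ta Tb I z m : invariant M Ta Tb I ->
  m \in reach (aut_trans M) (aut_initial M) z ->
  triple m (reach Ta [:: Leaf] (proj tfst z)) (reach Tb [:: Leaf] (proj tsnd z)) \in I.
Proof.
move=> /andP[/allP initI /allP stepI]; elim/last_ind: z m => [|z o IH] m.
  exact: initI.
rewrite reach_rcons !reach_proj !foldl_rcons -!reach_proj => /nstepP[t [tT tz to <-]].
have /allP/(_ _ tT)/implyP := stepI _ (IH _ tz).
by rewrite /state1 /state2 /= !ofseqK to; apply.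
Qed.

(** A triple with a final state describes an accepted pair of words. If the first word leads to the
    source of an [x]-edge of [T0], the second must lead to its target. *)
Definition inv_letter (M : tree) (T0 I : seq tree) (x : tree) : bool :=
  all (fun i => (tfst i \in aut_final M) ==>
    all (fun t => (lab t == x) && (src t \in state1 i) ==> (tgt t \in state2 i)) T0) I.

Definition inv_one (M : tree) (I : seq tree) : bool :=
  all (fun i => (tfst i \in aut_final M) ==>
    ((Leaf \in state1 i) ==> (Leaf \in state2 i))) I.

(** The input lists the multipliers in the order of [enum A], so the position of an entry is the
    code of its letter. Folding over [rev l] makes the size of the accumulator equal to that
    position. *)
Definition indexed (l : seq tree) : seq tree :=
  foldr (fun m a => Node (tnat (size a)) m :: a) [::] (rev l).

Definition multipliers (x : tree) : seq tree :=
  flatten [seq [:: Node (Node (tfst m) (tnat 0)) (tfst (tsnd m));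
                   Node (Node (tfst m) (tnat 1)) (tsnd (tsnd m))]
    | m <- indexed (tlist (tsnd (tsnd (tsnd (tfst x)))))].

Definition flip (x : tree) : tree := Node (tfst x) (tnat (~~ isnode (tsnd x))).
Definition winv (h : tree) : tree := ofseq (rev [seq flip x | x <- tlist h]).

Definition gens (x : tree) : seq tree := tlist (tsnd x).
Definition gens_inv (x : tree) : seq tree := gens x ++ [seq winv h | h <- gens x].

(* An item of [C] is a letter and a padded pair of words accepted by its multiplier. *)
Definition cert_edges (C : seq tree) : seq tree :=
  [seq Node (Node (ofseq (proj tfst (tlist (tsnd c)))) (tfst c))
            (ofseq (proj tsnd (tlist (tsnd c)))) | c <- C].

Definition subset_of (s t : seq tree) : bool := all (fun x => x \in t) s.

Definition check_cayley (x : tree) (C : seq tree) : bool :=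
  all (fun c => has (fun m => (tfst m == tfst c) && accepts (tsnd m) (tlist (tsnd c)))
    (multipliers x)) C.

(* [k] is a triple [(z, (w, v))]: [z] is a list of generators and of their inverses,
   and both [z ++ tgt e] and [src e ++ [:: lab e]] lead from [w] to [v], so that
   they are equal in the group. *)
Definition check_sound1 (x : tree) (C : seq tree) (k e : tree) : bool :=
  all (fun y => y \in gens_inv x) (tlist (tfst k)) &&
  (tsnd (tsnd k) \in reach (cert_edges C) [:: tfst (tsnd k)]
     (flatten [seq tlist y | y <- tlist (tfst k)] ++ tlist (tgt e))) &&
  (tsnd (tsnd k) \in reach (cert_edges C) [:: tfst (tsnd k)]
     (tlist (src e) ++ [:: Node (lab e) (tnat 0)])).

Definition check_sound (x : tree) (E C Z : seq tree) : bool :=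
  all (fun e => has (fun k => check_sound1 x C k e) Z) E.

Definition check_loops (x : tree) (E0 : seq tree) : bool :=
  all (fun h => Leaf \in reach (both E0) [:: Leaf] (tlist h)) (gens x).

Definition check_letters (x : tree) (E E0 Is : seq tree) : bool :=
  all (fun m => has (fun I => invariant (tsnd m) (both E) (both E) (tlist I) &&
    inv_letter (tsnd m) (both E0) (tlist I) (tfst m)) Is) (multipliers x).

(** The second word is read in [EG]: an [L]-word equal in the group to a loop of [E] at the root is
    a loop of [EG]. *)
Definition check_one (x : tree) (E EG Is : seq tree) : bool :=
  has (fun I => invariant (tfst (tsnd (tsnd (tfst x)))) (both E) (both EG) (tlist I) &&
    inv_one (tfst (tsnd (tsnd (tfst x)))) (tlist I)) Is.

(** Provides the first element for which the root is complete. *)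
Definition check_nonempty (x : tree) (E W : seq tree) : bool :=
  has (fun w => accepts (tfst (tsnd (tfst x))) (tlist w) &&
    (Leaf \in reach (both E) [:: Leaf] (tlist w))) W.

(** An edge has to occur on such a loop in one direction only, hence [has] over [both1 e]. The entry
    of [W] is the pair of the parts of the word before and after the edge. *)
Definition check_edges (x : tree) (EG W : seq tree) : bool :=
  all (fun e => has (fun t => has (fun w =>
    [&& accepts (tfst (tsnd (tfst x))) (tlist (tfst w) ++ lab t :: tlist (tsnd w)),
        src t \in reach (both EG) [:: Leaf] (tlist (tfst w)) &
        Leaf \in reach (both EG) [:: tgt t] (tlist (tsnd w))]) W) (both1 e)) EG.

Definition certG (c : tree) := tlist (tfst c).
Definition cert0 (c : tree) := tlist (tfst (tsnd c)).
Definition certE (c : tree) := tlist (tfst (tsnd (tsnd c))).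
Definition certI (c : tree) := tlist (tfst (tsnd (tsnd (tsnd c)))).
Definition certC (c : tree) := tlist (tfst (tsnd (tsnd (tsnd (tsnd c))))).
Definition certZ (c : tree) := tlist (tfst (tsnd (tsnd (tsnd (tsnd (tsnd c)))))).
Definition certW (c : tree) := tlist (tsnd (tsnd (tsnd (tsnd (tsnd (tsnd c)))))).

Definition certificate (EG E0 E I C Z W : seq tree) : tree :=
  Node (ofseq EG) (Node (ofseq E0) (Node (ofseq E)
    (Node (ofseq I) (Node (ofseq C) (Node (ofseq Z) (ofseq W)))))).

Lemma certificateE EG E0 E I C Z W (c := certificate EG E0 E I C Z W) :
  (certG c = EG) * (cert0 c = E0) * (certE c = E) * (certI c = I) *
  (certC c = C) * (certZ c = Z) * (certW c = W).
Proof. by do !split; apply: ofseqK. Qed.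

Definition check (x c : tree) : bool :=
  (subset_of (certG c) (cert0 c) && subset_of (cert0 c) (certE c)) &&
  (deterministic (both (certE c)) && check_cayley x (certC c)) &&
  (check_sound x (certE c) (certC c) (certZ c) && check_loops x (cert0 c)) &&
  (check_letters x (certE c) (cert0 c) (certI c) &&
   check_one x (certE c) (certG c) (certI c)) &&
  (check_nonempty x (certE c) (certW c) && check_edges x (certG c) (certW c)).

(** The root [Leaf] is a vertex even when there are no edges. *)
Definition verts (E : seq tree) : seq tree :=
  Leaf :: undup [seq v <- flatten [seq [:: src e; tgt e] | e <- E] | ~~ (v == Leaf)].

Definition output (x c : tree) : tree :=
  Node (tnat (size (verts (certG c))))
    (Node (tnat (index Leaf (verts (certG c))))
      (ofseq [seq Node (Node (tnat (index (src e) (verts (certG c)))) (lab e))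
                       (tnat (index (tgt e) (verts (certG c)))) | e <- certG c])).

(** * Computability of the checker *)

Section Computability.
Implicit Types (f g k M c : tree -> tree) (E T S C I Z W w : tree -> seq tree).

Lemma computable_src f : computable f -> computable (fun y => src (f y)).
Proof. by move=> ?; rewrite /src; computable_tac. Qed.

Lemma computable_lab f : computable f -> computable (fun y => lab (f y)).
Proof. by move=> ?; rewrite /lab; computable_tac. Qed.

Lemma computable_tgt f : computable f -> computable (fun y => tgt (f y)).
Proof. by move=> ?; rewrite /tgt; computable_tac. Qed.

Ltac computable_hook ::=
  match goal with
  | |- computable (fun y => src _) => apply: computable_src
  | |- computable (fun y => lab _) => apply: computable_lab
  | |- computable (fun y => tgt _) => apply: computable_tgt
  end.

Lemma computable_nstep T S f : computable_seq T -> computable_seq S -> computable f ->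
  computable_seq (fun y => nstep (T y) (S y) (f y)).
Proof. by move=> HT HS Hf; rewrite /nstep; computable_tac. Qed.

Lemma computable_reach T S w : computable_seq T -> computable_seq S -> computable_seq w ->
  computable_seq (fun y => reach (T y) (S y) (w y)).
Proof.
move=> HT HS Hw; rewrite /reach; apply: computable_foldl => //.
by apply: computable_nstep; computable_tac.
Qed.

Ltac computable_hook ::=
  match goal with
  | |- computable (fun y => src _) => apply: computable_src
  | |- computable (fun y => lab _) => apply: computable_lab
  | |- computable (fun y => tgt _) => apply: computable_tgt
  | |- computable_seq (fun y => nstep _ _ _) => apply: computable_nstep
  | |- computable_seq (fun y => reach _ _ _) => apply: computable_reach
  end.

Lemma computable_deterministic T : computable_seq T ->
  computable_bool (fun y => deterministic (T y)).
Proof. by move=> HT; rewrite /deterministic; computable_tac. Qed.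

Lemma computable_accepts M w : computable M -> computable_seq w ->
  computable_bool (fun y => accepts (M y) (w y)).
Proof.
by move=> HM Hw; rewrite /accepts /aut_trans /aut_initial /aut_final; computable_tac.
Qed.

Lemma computable_both1 f : computable f -> computable_seq (fun y => both1 (f y)).
Proof. by move=> Hf; rewrite /both1; computable_tac. Qed.

Lemma computable_both E : computable_seq E -> computable_seq (fun y => both (E y)).
Proof. by move=> HE; rewrite /both /both1; computable_tac. Qed.

Lemma computable_invariant M T S I : computable M -> computable_seq T ->
  computable_seq S -> computable_seq I ->
  computable_bool (fun y => invariant (M y) (T y) (S y) (I y)).
Proof.
move=> HM HT HS HI; rewrite /invariant /triple /ostep /state1 /state2 /aut_initial /aut_trans.
by computable_tac.
Qed.

Lemma computable_multipliers f : computable f ->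
  computable_seq (fun y => multipliers (f y)).
Proof. by move=> Hf; rewrite /multipliers /indexed; computable_tac. Qed.

Lemma computable_gens f : computable f -> computable_seq (fun y => gens (f y)).
Proof. by move=> Hf; rewrite /gens; computable_tac. Qed.

Lemma computable_gens_inv f : computable f -> computable_seq (fun y => gens_inv (f y)).
Proof. by move=> Hf; rewrite /gens_inv /winv /flip /gens; computable_tac. Qed.

Lemma computable_cert_edges C : computable_seq C ->
  computable_seq (fun y => cert_edges (C y)).
Proof. by move=> HC; rewrite /cert_edges /proj; computable_tac. Qed.

Ltac computable_hook ::=
  match goal with
  | |- computable (fun y => src _) => apply: computable_src
  | |- computable (fun y => lab _) => apply: computable_lab
  | |- computable (fun y => tgt _) => apply: computable_tgt
  | |- computable_seq (fun y => nstep _ _ _) => apply: computable_nstep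
  | |- computable_seq (fun y => reach _ _ _) => apply: computable_reach
  | |- computable_bool (fun y => deterministic _) => apply: computable_deterministic
  | |- computable_bool (fun y => accepts _ _) => apply: computable_accepts
  | |- computable_seq (fun y => both1 _) => apply: computable_both1
  | |- computable_seq (fun y => both _) => apply: computable_both
  | |- computable_bool (fun y => invariant _ _ _ _) => apply: computable_invariant
  | |- computable_seq (fun y => multipliers _) => apply: computable_multipliers
  | |- computable_seq (fun y => gens _) => apply: computable_gens
  | |- computable_seq (fun y => gens_inv _) => apply: computable_gens_inv
  | |- computable_seq (fun y => cert_edges _) => apply: computable_cert_edges
  end.

Lemma computable_check_cayley f C : computable f -> computable_seq C ->
  computable_bool (fun y => check_cayley (f y) (C y)).
Proof.
move=> Hf HC; rewrite /check_cayley.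
by computable_tac.
Qed.

Lemma computable_check_sound1 f C k g : computable f -> computable_seq C ->
  computable k -> computable g ->
  computable_bool (fun y => check_sound1 (f y) (C y) (k y) (g y)).
Proof.
move=> Hf HC Hk Hg; rewrite /check_sound1.
by computable_tac.
Qed.

Lemma computable_check_sound f E C Z : computable f -> computable_seq E ->
  computable_seq C -> computable_seq Z ->
  computable_bool (fun y => check_sound (f y) (E y) (C y) (Z y)).
Proof.
move=> Hf HE HC HZ; rewrite /check_sound.
by computable_tac.
Qed.

Lemma computable_check_loops f E : computable f -> computable_seq E ->
  computable_bool (fun y => check_loops (f y) (E y)).
Proof.
move=> Hf HE; rewrite /check_loops.
by computable_tac.
Qed.

Lemma computable_check_letters f E S I : computable f -> computable_seq E ->
  computable_seq S -> computable_seq I ->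
  computable_bool (fun y => check_letters (f y) (E y) (S y) (I y)).
Proof.
move=> Hf HE HS HI; rewrite /check_letters /inv_letter /state1 /state2 /aut_final.
by computable_tac.
Qed.

Lemma computable_check_one f E S I : computable f -> computable_seq E ->
  computable_seq S -> computable_seq I ->
  computable_bool (fun y => check_one (f y) (E y) (S y) (I y)).
Proof.
move=> Hf HE HS HI; rewrite /check_one /inv_one /state1 /state2 /aut_final.
by computable_tac.
Qed.

Lemma computable_check_nonempty f E W : computable f -> computable_seq E ->
  computable_seq W -> computable_bool (fun y => check_nonempty (f y) (E y) (W y)).
Proof.
move=> Hf HE HW; rewrite /check_nonempty.
by computable_tac.
Qed.

Lemma computable_check_edges f E W : computable f -> computable_seq E ->
  computable_seq W -> computable_bool (fun y => check_edges (f y) (E y) (W y)).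
Proof.
move=> Hf HE HW; rewrite /check_edges.
by computable_tac.
Qed.

Lemma computable_verts E : computable_seq E -> computable_seq (fun y => verts (E y)).
Proof. by move=> HE; rewrite /verts; computable_tac. Qed.

Ltac computable_hook ::=
  match goal with
  | |- computable (fun y => src _) => apply: computable_src
  | |- computable (fun y => lab _) => apply: computable_lab
  | |- computable (fun y => tgt _) => apply: computable_tgt
  | |- computable_seq (fun y => nstep _ _ _) => apply: computable_nstep
  | |- computable_seq (fun y => reach _ _ _) => apply: computable_reach
  | |- computable_bool (fun y => deterministic _) => apply: computable_deterministic
  | |- computable_bool (fun y => accepts _ _) => apply: computable_accepts
  | |- computable_seq (fun y => both1 _) => apply: computable_both1
  | |- computable_seq (fun y => both _) => apply: computable_both
  | |- computable_bool (fun y => invariant _ _ _ _) => apply: computable_invariant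
  | |- computable_seq (fun y => multipliers _) => apply: computable_multipliers
  | |- computable_seq (fun y => gens _) => apply: computable_gens
  | |- computable_seq (fun y => gens_inv _) => apply: computable_gens_inv
  | |- computable_seq (fun y => cert_edges _) => apply: computable_cert_edges
  | |- computable_bool (fun y => check_cayley _ _) => apply: computable_check_cayley
  | |- computable_bool (fun y => check_sound1 _ _ _ _) => apply: computable_check_sound1
  | |- computable_bool (fun y => check_sound _ _ _ _) => apply: computable_check_sound
  | |- computable_bool (fun y => check_loops _ _) => apply: computable_check_loops
  | |- computable_bool (fun y => check_letters _ _ _ _) => apply: computable_check_letters
  | |- computable_bool (fun y => check_one _ _ _ _) => apply: computable_check_one
  | |- computable_bool (fun y => check_nonempty _ _ _) => apply: computable_check_nonempty
  | |- computable_bool (fun y => check_edges _ _ _) => apply: computable_check_edges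
  | |- computable_seq (fun y => verts _) => apply: computable_verts
  end.

Lemma computable_check : computable_bool (fun y => check (tfst y) (tsnd y)).
Proof.
rewrite /check /subset_of /certG /cert0 /certE /certI /certC /certZ /certW.
by computable_tac.
Qed.

Lemma computable_output : computable (fun y => output (tfst y) (tsnd y)).
Proof.
rewrite /output /certG.
by computable_tac.
Qed.

End Computability.

(** * Inputs *)

Lemma enc_bool_inj : injective enc_bool.
Proof. by case=> [] []. Qed.

Lemma enc_alpha_inj (A : finType) : injective (@enc_alpha A).
Proof. by move=> a b /tnat_inj/val_inj/enum_rank_inj. Qed.

Lemma enc_letter_inj (A : finType) : injective (@enc_letter A).
Proof.
by move=> [a b] [a' b'] [/enc_alpha_inj-> /enc_bool_inj->].
Qed.

Lemma indexedP l m :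
  m \in indexed l <-> exists2 k, k < size l & m = Node (tnat k) (nth Leaf l k).
Proof.
have indexed_rcons s y : indexed (rcons s y) = Node (tnat (size (indexed s))) y :: indexed s.
  by rewrite /indexed rev_rcons.
have size_indexed s : size (indexed s) = size s.
  by elim/last_ind: s => // s y IH; rewrite indexed_rcons /= IH size_rcons.
elim/last_ind: l m => [|l y IH] m; first by split=> // -[].
rewrite indexed_rcons inE size_indexed size_rcons; split.
  case/orP=> [/eqP->|/IH[k kl ->]]; first by exists (size l); rewrite ?nth_rcons ?ltnn ?eqxx.
  by exists k; rewrite ?nth_rcons ?kl // ltnS ltnW.
move=> [k kl ->]; rewrite nth_rcons; case: (ltngtP k (size l)) kl => [kl _|lk|-> _].
- by apply/orP; right; apply/IH; exists k.
- by rewrite ltnS leqNgt lk.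
- by rewrite eqxx.
Qed.

Section Input.
Local Open Scope group_scope.
Variables (A : finType) (G : groupType) (mu : word A -> G) (D : automata A) (hs : seq (word A)).
Hypothesis muP : inverse_epimorphism mu.
Hypothesis autD : automatic_structure mu D.

Let x := enc_input D hs.
Let enc := map (@enc_letter A).
Let L := language D.

Lemma mu_nil : mu [::] = 1. Proof. by case: muP. Qed.
Lemma mu_cat u v : mu (u ++ v) = mu u * mu v. Proof. by case: muP => _ ->. Qed.
Lemma mu_linv y : mu [:: linv y] = (mu [:: y])^-1. Proof. by case: muP => _ _ ->. Qed.
Lemma mu_surj g : exists w, mu w = g. Proof. by case: muP => _ _ _; apply. Qed.
Lemma mu_rcons u y : mu (rcons u y) = mu u * mu [:: y].
Proof. by rewrite -cats1 mu_cat. Qed.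
Lemma mu_cons y u : mu (y :: u) = mu [:: y] * mu u.
Proof. by rewrite -cat1s mu_cat. Qed.

Lemma representative g : exists2 w, L w & mu w = g.
Proof.
have [_ muL _] := autD.
by have : [set: G]%classic g by []; rewrite -muL => -[w Lw <-]; exists w.
Qed.

Lemma multipliersP m : m \in multipliers x <->
  exists y : letter A, m = Node (@enc_letter A y) (enc_multiplier (multiplier D (Some y))).
Proof.
have -> : multipliers x = flatten [seq [:: Node (Node (tfst m) (tnat 0)) (tfst (tsnd m));
      Node (Node (tfst m) (tnat 1)) (tsnd (tsnd m))]
    | m <- indexed [seq Node (enc_multiplier (multiplier D (Some (a, false))))
                 (enc_multiplier (multiplier D (Some (a, true)))) | a <- enum A]].
  by rewrite /multipliers /x /= tlist_enc_seq.
split=> [/flatten_mapP[m' /indexedP[k + ->]]|[[a b] ->]].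
  rewrite size_map -cardE => kA; pose a := enum_val (Ordinal kA).
  rewrite (nth_map a) -?cardE // -[nth a _ k]/(nth a (enum A) (Ordinal kA)) /=.
  have -> : nth a (enum A) k = a by rewrite -[k]/(nat_of_ord (Ordinal kA)) -(enum_val_nth a (Ordinal kA)).
  have -> : k = enum_rank a by rewrite /a enum_valK.
  by rewrite !inE => /orP[] /eqP->; [exists (a, false) | exists (a, true)].
apply/flatten_mapP; exists (Node (enc_alpha a)
  (Node (enc_multiplier (multiplier D (Some (a, false))))
        (enc_multiplier (multiplier D (Some (a, true)))))).
  apply/indexedP; exists (enum_rank a); first by rewrite size_map -cardE.
  by rewrite (nth_map a) -?cardE // nth_enum_rank.
by case: b; rewrite !inE eqxx ?orbT.
Qed.

Lemma accepts_language w :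
  accepts (tfst (tsnd (tfst x))) w <-> exists2 w', w = enc w' & L w'.
Proof. exact: acceptsP. Qed.

Lemma accepts_enc w : accepts (tfst (tsnd (tfst x))) (enc w) <-> L w.
Proof.
split=> [/accepts_language[w' /(inj_map (@enc_letter_inj A))->]|Lw] //.
by apply/accepts_language; exists w.
Qed.

Lemma accepts_multiplier y z : accepts (enc_multiplier (multiplier D y)) z <->
  exists u v, [/\ L u, L v, mu (u ++ seq_of_opt y) = mu v
                & z = map (@enc_optpair A) (pad u v)].
Proof.
have [_ _ /(_ y) accE] := autD.
apply: (iff_trans (acceptsP (@enc_optpair A) _ _)); rewrite accE.
split=> [[z' -> [u [v [? ? ? ->]]]]|[u [v [? ? ? ->]]]]; first by exists u, v.
by exists (pad u v) => //; exists u, v.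
Qed.

Lemma proj_pad (u v : word A) :
  (proj tfst (map (@enc_optpair A) (pad u v)) = enc u) *
  (proj tsnd (map (@enc_optpair A) (pad u v)) = enc v).
Proof. by have [uE vE] := pmap_pad u v; rewrite proj1_enc proj2_enc uE vE. Qed.

(** * Interpretation of trees in the group *)

(* Trees that do not encode letters are interpreted by [1], so that the checker
   need not test that the labels of a certificate are letters. *)
Definition nu1 (t : tree) : G :=
  if [pick y : letter A | enc_letter y == t] is Some y then mu [:: y] else 1.

Definition nu (s : seq tree) : G := foldr (fun t g => nu1 t * g) 1 s.

Lemma nu1_enc y : nu1 (enc_letter y) = mu [:: y].
Proof.
rewrite /nu1; case: pickP => [z /eqP/enc_letter_inj-> //|/(_ y)].
by rewrite eqxx.
Qed.

Lemma nu_cat s t : nu (s ++ t) = nu s * nu t.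
Proof. by elim: s => /= [|y s ->]; rewrite ?mul1g ?mulgA. Qed.

Lemma nu_seq1 y : nu [:: y] = nu1 y.
Proof. exact: mulg1. Qed.

Lemma nu_enc w : nu (enc w) = mu w.
Proof. by elim: w => /= [|y w ->]; rewrite ?mu_nil // nu1_enc -mu_cons. Qed.

(** If [a] is not the code of an element of the alphabet, both sides are 1. *)
Lemma nu1_inv a : nu1 (Node a (tnat 1)) = (nu1 (Node a (tnat 0)))^-1.
Proof.
rewrite {2}/nu1; case: pickP => [[b []] /eqP // [<-]|noa].
  by rewrite -mu_linv -nu1_enc.
rewrite invg1 /nu1; case: pickP => // -[b []] /eqP // [bE].
by have := noa (b, false); rewrite /enc_letter /enc_pair /= bE eqxx.
Qed.

(** * The generated subgroup and its right cosets *)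

Let H := generated mu hs.

Lemma subgroup_generated : subgroup H.
Proof.
split=> [|g h Hg Hh|g Hg] K sK; have [[K1 KM KV] _] := sK; first exact: K1.
- by apply: KM; [exact: Hg K sK | exact: Hh K sK].
- by apply: KV; exact: Hg K sK.
Qed.

Lemma H1 : H 1. Proof. by case: subgroup_generated. Qed.
Lemma HM g h : H g -> H h -> H (g * h). Proof. by case: subgroup_generated => _ + _; apply. Qed.
Lemma HV g : H g -> H g^-1. Proof. by case: subgroup_generated => _ _; apply. Qed.

Lemma generated_in h : h \in hs -> H (mu h).
Proof. by move=> hhs K [_]; apply; exists h. Qed.

(** Induction principle for the elements of [H]. *)
Lemma generated_min (K : set G) : subgroup K -> (forall h, h \in hs -> K (mu h)) ->
  forall g, H g -> K g.
Proof.
move=> sK hK g Hg; apply: (Hg K); split=> // _ [h hh <-]; exact: hK.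
Qed.

Lemma rcoset_eq g h : rcoset H g = rcoset H h <-> H (g * h^-1).
Proof.
split=> [E|Hgh].
  have : rcoset H g g by exists 1; rewrite ?mul1g //; apply: H1.
  by rewrite E => -[k Hk <-]; rewrite mulgK.
apply/seteqP; split=> _ [k Hk <-].
  by exists (k * (g * h^-1)); [apply: HM | rewrite -!mulgA mulVg mulg1].
exists (k * (g * h^-1)^-1); first by apply: HM => //; apply: HV.
by rewrite invgM invgK -!mulgA mulVg mulg1.
Qed.

Lemma rcoset1 : rcoset H 1 = H.
Proof.
apply/seteqP; split=> [_ [k Hk <-]|k Hk]; first by rewrite mulg1.
by exists k; rewrite ?mulg1.
Qed.

Lemma rcoset_H g : rcoset H g = H <-> H g.
Proof. by rewrite -{2}rcoset1 rcoset_eq invg1 mulg1. Qed.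

Lemma rcosetM g h k : rcoset H g = rcoset H h -> rcoset H (g * k) = rcoset H (h * k).
Proof. by move=> /rcoset_eq E; apply/rcoset_eq; rewrite invgM mulgA mulgK. Qed.

(** * Generators and their formal inverses *)

Lemma gensE : gens x = map (@enc_word A) hs.
Proof. exact: tlist_enc_seq. Qed.

Definition winvw (w : word A) : word A := rev (map (@linv A) w).

Lemma mu_winvw w : mu (winvw w) = (mu w)^-1.
Proof.
rewrite /winvw; elim: w => /= [|y w IH]; first by rewrite mu_nil invg1.
by rewrite rev_cons mu_rcons IH mu_linv (mu_cons y w) invgM.
Qed.

Lemma winvE (w : word A) : winv (enc_word w) = enc_word (winvw w).
Proof.
rewrite /winv /winvw /enc_word tlist_enc_seq enc_seqE -map_comp map_rev -map_comp.
by congr (ofseq (rev _)); apply: eq_map => -[a []].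
Qed.

Lemma gens_invE : gens_inv x = map (@enc_word A) (hs ++ map winvw hs).
Proof.
rewrite /gens_inv gensE map_cat -!map_comp; congr (_ ++ _).
by apply: eq_map => w /=; rewrite winvE.
Qed.

(** * Stallings graph *)

(** Letters of both signs act on the cosets by right multiplication, so a label determines its path
    and every word can be read from every vertex. *)
Lemma schreier_edge g y (Q : set G) :
  edges (schreier mu H) (traversed (rcoset H g) y Q) <-> Q = rcoset H (g * mu [:: y]).
Proof.
case: y => a [] /=; rewrite /traversed /=; split.
- move=> [g' [a' [QE <- /rcosetM gE]]]; rewrite QE.
  rewrite -[g'](mulgK (mu [:: (a, false)])); rewrite -(gE _).
  by rewrite -mu_linv.
- move=> ->; exists (g * mu [:: (a, true)]), a.
  by rewrite -mulgA -[(a, true)]/(linv (a, false)) mu_linv mulVg mulg1.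
- by move=> [g' [a' [/rcosetM gE -> ->]]]; rewrite gE.
- by move=> ->; exists g, a.
Qed.

Lemma schreier_path g w (Q : set G) :
  path_labeled (schreier mu H) (rcoset H g) w Q <-> Q = rcoset H (g * mu w).
Proof.
elim: w g => [|y w IH] g /=.
  rewrite mu_nil mulg1; split=> [[_ ->//]|->]; split=> //; exact: imageT.
split=> [[_ [r /schreier_edge-> /IH->]]|QE]; first by rewrite -mulgA -mu_cons.
split; first exact: imageT.
exists (rcoset H (g * mu [:: y])); first exact/schreier_edge.
by apply/IH; rewrite -mulgA -mu_cons.
Qed.

Lemma schreier_path_root w (Q : set G) :
  path_labeled (schreier mu H) H w Q <-> Q = rcoset H (mu w).
Proof. by have := schreier_path 1 w Q; rewrite rcoset1 mul1g. Qed.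

Let S := stallings mu L H.

Lemma stallings_vertex C : vertices S C <->
  exists u v, [/\ L (u ++ v), H (mu (u ++ v)) & C = rcoset H (mu u)].
Proof.
split=> [[u [v [[Lw Hw] /schreier_path_root CE _]]]|[u [v [Lw Hw ->]]]].
  by exists u, v.
exists u, v; split=> //; first exact/schreier_path_root.
by apply/schreier_path; apply/esym/rcoset_H; rewrite -mu_cat.
Qed.

Lemma stallings_edge C a C' : edges S (C, a, C') <->
  exists u y v, [/\ L (u ++ y :: v), H (mu (u ++ y :: v)) &
    (C, a, C') = traversed (rcoset H (mu u)) y (rcoset H (mu (rcons u y)))].
Proof.
split=> [[u [y [v [p [q [[Lw Hw] /schreier_path_root-> /schreier_edge-> _ ->]]]]]]|].
  by exists u, y, v; rewrite mu_rcons.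
move=> [u [y [v [Lw Hw ->]]]].
exists u, y, v, (rcoset H (mu u)), (rcoset H (mu (rcons u y))); split=> //.
- exact/schreier_path_root.
- by apply/schreier_edge; rewrite mu_rcons.
- by apply/schreier_path; apply/esym/rcoset_H; rewrite -mu_cat cat_rcons.
Qed.

(** * Correctness of the certificates *)

Section Soundness.
Variable c : tree.
Hypothesis chk : check x c.

Let TG := both (certG c).
Let T0 := both (cert0 c).
Let T := both (certE c).
Let N p := nu (tlist p).

Lemma bothP E t : reflect (exists2 e, e \in E & t \in both1 e) (t \in both E).
Proof. exact: flatten_mapP. Qed.

Lemma both_mono E E' : {subset E <= E'} -> {subset both E <= both E'}.
Proof. by move=> sE t /bothP[e eE te]; apply/bothP; exists e; auto. Qed.

Lemma both_inv E t (y : letter A) : t \in both E -> lab t = enc_letter y ->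
  Node (Node (tgt t) (enc_letter (linv y))) (src t) \in both E.
Proof.
move=> /bothP[e eE te]; case: y => a b ty; apply/bothP; exists e => //.
move: te ty; rewrite !inE /enc_letter /enc_pair /= => /orP[] /eqP-> [<-];
by case: b => // _; rewrite eqxx ?orbT.
Qed.

Lemma sub_TG_T0 : {subset TG <= T0}.
Proof. by move: chk => /andP[/andP[/andP[/andP[/andP[/allP s _] _] _] _] _]; apply: both_mono. Qed.

Lemma sub_T0_T : {subset T0 <= T}.
Proof. by move: chk => /andP[/andP[/andP[/andP[/andP[_ /allP s] _] _] _] _]; apply: both_mono. Qed.

Lemma det_T : deterministic T.
Proof. by move: chk => /andP[/andP[/andP[/andP[_ /andP[]]]]]. Qed.

(** Each item carries a pair accepted by the multiplier of its letter, so its edge is an edge of the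
    Cayley graph between the elements that the two words represent. *)
Lemma cayley_sound t : t \in cert_edges (certC c) -> N (src t) * nu1 (lab t) = N (tgt t).
Proof.
have : check_cayley x (certC c) by move: chk => /andP[/andP[/andP[/andP[_ /andP[]]]]].
move=> /allP cayC /mapP[k /cayC/hasP[m /multipliersP[y ->] /andP[/eqP yk]]] /=.
move=> /accepts_multiplier[u [v [_ _ uv kE]]] ->; rewrite /N /src /lab /tgt /=.
by rewrite -[tfst k]yk !ofseqK kE !proj_pad !nu_enc nu1_enc -mu_cat.
Qed.

Lemma cayley_reach p w q : q \in reach (cert_edges (certC c)) [:: p] w ->
  N p * nu w = N q.
Proof.
elim/last_ind: w q => [|w y IH] q; first by rewrite inE => /eqP->; rewrite mulg1.
rewrite reach_rcons => /nstepP[t [tC /IH tw <- <-]].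
by rewrite -cats1 nu_cat nu_seq1 mulgA tw cayley_sound.
Qed.

Lemma gens_inv_sound y : y \in gens_inv x -> H (N y).
Proof.
rewrite gens_invE => /mapP[w + ->]; rewrite /N /enc_word tlist_enc_seq nu_enc mem_cat.
case/orP=> [/generated_in//|/mapP[h /generated_in Hh ->]].
by rewrite mu_winvw; apply: HV.
Qed.

Lemma edge_sound t : t \in T -> H (N (src t) * nu1 (lab t) * (N (tgt t))^-1).
Proof.
have sndE : check_sound x (certE c) (certC c) (certZ c).
  by move: chk => /andP[/andP[/andP[_ /andP[]]]].
move=> /bothP[e /(allP sndE)/hasP[k _ /andP[/andP[/allP kz /cayley_reach k1]]]].
(* Both paths join the same two words; cancelling the start leaves an equality between [src e]
   followed by its letter and [z] followed by [tgt e]. *)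
move=> /cayley_reach; rewrite -{}k1 !nu_cat nu_seq1 => /mulgI.
set z := nu (flatten _) => zE.
have Hz : H (N (src e) * nu1 (Node (lab e) (tnat 0)) * (N (tgt e))^-1).
  rewrite /N zE mulgK /z; elim: (tlist (tfst k)) kz => /= [|y l IH] kz; first exact: H1.
  rewrite nu_cat; apply: HM; first by apply: gens_inv_sound; apply: kz; rewrite mem_head.
  by apply: IH => y' y'l; apply: kz; rewrite inE y'l orbT.
(* Read backwards, the edge yields the inverse of the same element of [H]. *)
rewrite !inE => /orP[/eqP->//|/eqP->]; rewrite /src /lab /tgt /= -/(src e) -/(lab e) -/(tgt e).
by rewrite -[Node Leaf Leaf]/(tnat 1) nu1_inv; move/HV: Hz; rewrite !invgM invgK mulgA.
Qed.

Lemma reach_sound p w q : q \in reach T [:: p] w -> H (N p * nu w * (N q)^-1).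
Proof.
elim/last_ind: w q => [|w y IH] q.
  by rewrite inE => /eqP->; rewrite mulg1 mulgV; apply: H1.
rewrite reach_rcons => /nstepP[t [tT /IH Hw <- <-]].
have := HM Hw (edge_sound tT); rewrite -cats1 nu_cat nu_seq1.
by rewrite !mulgA mulgVK.
Qed.

Lemma rcoset_reach w p : p \in reach T [:: Leaf] (enc w) ->
  rcoset H (mu w) = rcoset H (N p).
Proof. by move=> /reach_sound; rewrite nu_enc mul1g => ?; apply/rcoset_eq. Qed.

(** The multiplier of [y] accepts the pair [(u, v)]; the invariant contains the triple at the end of
    this run, to which [inv_letter] applies. *)
Lemma letter_closed t (y : letter A) u v : t \in T0 -> lab t = enc_letter y -> L u -> L v ->
  mu u * mu [:: y] = mu v -> src t \in reach T [:: Leaf] (enc u) ->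
  tgt t \in reach T [:: Leaf] (enc v).
Proof.
have /allP chkL : check_letters x (certE c) (cert0 c) (certI c).
  by move: chk => /andP[/andP[_ /andP[]]].
move=> tT ty Lu Lv uv tu; pose z := map (@enc_optpair A) (pad u v).
have : accepts (enc_multiplier (multiplier D (Some y))) z.
  by apply/accepts_multiplier; exists u, v; rewrite mu_cat.
have /hasP[I _ /andP[]] := chkL _ ((multipliersP _).2 (ex_intro _ y erefl)).
move=> /invariantP invI /allP finI /hasP[m /invI/finI].
rewrite /state1 /state2 /= !ofseqK !proj_pad => /implyP mI /mI/allP/(_ _ tT)/implyP.
by rewrite ty eqxx tu; apply.
Qed.

Lemma one_closed u v : L u -> L v -> mu u = mu v ->
  Leaf \in reach T [:: Leaf] (enc u) -> Leaf \in reach TG [:: Leaf] (enc v).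
Proof.
have /hasP[I _ /andP[/invariantP invI /allP finI]] : check_one x (certE c) (certG c) (certI c).
  by move: chk => /andP[/andP[_ /andP[]]].
move=> Lu Lv uv Tu.
have /hasP[m /invI/finI] : accepts (enc_multiplier (multiplier D None)) (map (@enc_optpair A) (pad u v)).
  by apply/accepts_multiplier; exists u, v; rewrite cats0.
rewrite /state1 /state2 /= !ofseqK !proj_pad => /implyP mI /mI.
by rewrite Tu.
Qed.

(** * Completeness of vertices *)

Definition complete p g := forall v, L v -> mu v = g -> p \in reach T [:: Leaf] (enc v).

(** Forwards, compare each representative of the product with some representative of [g]. Backwards,
    apply the same to the edge read with the inverse letter. *)
Lemma complete_step t (y : letter A) g : t \in T0 -> lab t = enc_letter y ->
  complete (src t) g <-> complete (tgt t) (g * mu [:: y]).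
Proof.
have step t' (y' : letter A) g' : t' \in T0 -> lab t' = enc_letter y' -> complete (src t') g' ->
    complete (tgt t') (g' * mu [:: y']).
  move=> t'T ty' cg v Lv vg; have [u Lu ug] := representative g'.
  by apply: (letter_closed t'T ty' Lu) => //; [rewrite ug | apply: cg].
move=> tT ty; split; first exact: step.
move=> /(step _ (linv y) _ (both_inv tT ty) erefl).
by rewrite mu_linv mulgK.
Qed.

Lemma complete_path p w q g : q \in reach T0 [:: p] (enc w) ->
  complete p g <-> complete q (g * mu w).
Proof.
elim/last_ind: w q => [|w y IH] q; first by rewrite inE => /eqP->; rewrite mu_nil mulg1.
rewrite /enc map_rcons reach_rcons => /nstepP[t [tT /IH-> ty <-]].
by rewrite (complete_step _ tT ty) mu_rcons mulgA.
Qed.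

(** The root is complete for the element of one [L]-word looping in [E], by [one_closed]. This
    element lies in [H], and right translation by [H] preserves completeness of the root. *)
Lemma complete_root h : H h -> complete Leaf h.
Proof.
have /hasP[w _ /andP[/accepts_language[w0 -> Lw0] Tw0]] : check_nonempty x (certE c) (certW c).
  by move: chk => /andP[_ /andP[]].
have /rcoset_H Hw0 : rcoset H (mu w0) = H.
  by rewrite (rcoset_reach Tw0) /N /= rcoset1.
have /allP loops : check_loops x (cert0 c) by move: chk => /andP[/andP[/andP[_ /andP[]]]].
(* The elements whose right translation preserves completeness of the root form a subgroup; it
   contains the generators, which are loops of [E0] at the root. *)
have inv : forall g, H g -> forall k, complete Leaf k <-> complete Leaf (k * g).
  apply: generated_min => [|h' h'hs k].
    split=> [k|g g' Hg Hg' k|g Hg k]; first by rewrite mulg1.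
      by apply: (iff_trans (Hg k)); rewrite mulgA; apply: Hg'.
    by apply: iff_sym; have := Hg (k * g^-1); rewrite mulgVK.
  apply: complete_path; have := loops (enc_word h').
  by rewrite /enc_word tlist_enc_seq; apply; rewrite gensE map_f.
move=> Hh; rewrite -[h](mulVKg (mu w0)) -inv; last by apply: HM => //; apply: HV.
move=> v Lv vw0; apply: (reach_mono _ _ (one_closed Lw0 Lv _ Tw0)) => // t tG.
by apply: sub_T0_T; apply: sub_TG_T0.
Qed.

(** * The certified graph as a copy of the Stallings graph *)

Let V := verts (certG c).
Let coset p := rcoset H (N p).

(** Completeness of the root makes [w] a loop in [E]; comparing [w] with itself through [one_closed]
    moves the loop into [EG]. *)
Lemma loop_read w : L w -> H (mu w) -> Leaf \in reach TG [:: Leaf] (enc w).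
Proof. by move=> Lw Hw; apply: (one_closed Lw) => //; apply: (complete_root Hw). Qed.

Lemma mem_verts p :
  p \in V <-> p = Leaf \/ exists2 e, e \in certG c & p = src e \/ p = tgt e.
Proof.
rewrite inE mem_undup mem_filter; case: eqP => [->|pL] /=; first by split=> // _; left.
split=> [/flatten_mapP[e eG]|[//|[e eG pe]]].
  by rewrite !inE => /orP[]/eqP->; right; exists e; auto.
by apply/flatten_mapP; exists e => //; rewrite !inE; case: pe => ->; rewrite eqxx ?orbT.
Qed.

Lemma reach_verts w q : q \in reach TG [:: Leaf] w -> q \in V.
Proof.
elim/last_ind: w q => [|w y IH] q; first by rewrite !inE => ->.
rewrite reach_rcons => /nstepP[t [/bothP[e eG te] _ _ <-]]; apply/mem_verts.
by right; exists e => //; move: te; rewrite !inE => /orP[]/eqP->; auto.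
Qed.

Lemma reach_TG_T p w q : q \in reach TG [:: p] w -> q \in reach T [:: p] w.
Proof. by apply: reach_mono => // t /sub_TG_T0/sub_T0_T. Qed.

Lemma reach_TG_coset w p : p \in reach TG [:: Leaf] (enc w) -> coset p = rcoset H (mu w).
Proof. by move=> /reach_TG_T/rcoset_reach ->. Qed.

Lemma edge_loop e : e \in certG c -> exists t (y : letter A) u v,
  [/\ t \in both1 e, lab t = enc_letter y, L (u ++ y :: v) /\ H (mu (u ++ y :: v)),
      src t \in reach TG [:: Leaf] (enc u) & Leaf \in reach TG [:: tgt t] (enc v)].
Proof.
have /allP edgeC : check_edges x (certG c) (certW c) by move: chk => /andP[_ /andP[]].
move=> eG; have /hasP[t te /hasP[w _]] := edgeC e eG.
move=> /and3P[/accepts_language[w' w'E Lw'] tu tv].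
(* The accepted word is the code of a word of [L], so cutting it at the given place cuts that word,
   and the pieces of the certificate are codes. *)
have [u [y [v [w'uv uE yE vE]]]] : exists u y v, [/\ w' = u ++ y :: v,
    tlist (tfst w) = enc u, lab t = enc_letter y & tlist (tsnd w) = enc v].
  have szw : size (tlist (tfst w)) <= size w'.
    by rewrite -(size_map (@enc_letter A)) -/(enc w') -w'E size_cat leq_addr.
  move: w'E; rewrite -(cat_take_drop (size (tlist (tfst w))) w') /enc map_cat.
  set u := take _ _; set v := drop _ _ => /eqP; rewrite eqseq_cat; last first.
    by rewrite size_map size_takel.
  move=> /andP[/eqP uE]; case: v => [//|y v] /=; rewrite eqseq_cons => /andP[/eqP yE /eqP vE].
  by exists u, y, v.
move: tu tv Lw'; rewrite uE vE w'uv => tu tv Lw'.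
exists t, y, u, v; split=> //; split=> //; apply/rcoset_H.
have tT : t \in TG by apply/bothP; exists e.
have := reach_join tu (reach_join (reach_edge tT) tv); rewrite yE.
rewrite -[_ ++ _]/(enc u ++ enc (y :: v)) -map_cat => /reach_TG_coset <-.
by rewrite /coset /N rcoset1.
Qed.

Lemma vert_access p : p \in V ->
  exists u v, [/\ L (u ++ v), H (mu (u ++ v)) & p \in reach TG [:: Leaf] (enc u)].
Proof.
move=> /mem_verts[->|[e eG pe]].
  by have [w Lw w1] := representative 1; exists [::], w; rewrite /= w1; split=> //; apply: H1.
have [t [y [u [v [te ty [Lw Hw] tu _]]]]] := edge_loop eG.
have [->|->] : p = src t \/ p = tgt t.
- by move: te pe; rewrite !inE => /orP[]/eqP-> []; auto.
- by exists u, (y :: v).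
exists (rcons u y), v; rewrite cat_rcons; split=> //.
rewrite /enc map_rcons reach_rcons; apply/nstepP; exists t; split=> //.
by apply/bothP; exists e.
Qed.

(** A vertex reached in [EG] by [w] is complete for every element of the coset of [w]. If two
    vertices have the same coset, one [L]-word leads from the root to both in [E], which is
    deterministic. *)
Lemma coset_inj p q : p \in V -> q \in V -> coset p = coset q -> p = q.
Proof.
have access r : r \in V -> exists2 w, coset r = rcoset H (mu w) &
    forall h, H h -> complete r (h * mu w).
  move=> /vert_access[w [_ [_ _ rw]]]; exists w; first exact: reach_TG_coset.
  move=> h Hh; apply/(complete_path _ (reach_mono sub_TG_T0 (fun _ => id) rw)).
  exact: complete_root.
move=> /access[w pE pc] /access[w' qE qc] pq.
have /rcoset_eq Hw : rcoset H (mu w) = rcoset H (mu w') by rewrite -pE -qE.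
have [v Lv vE] := representative (mu w).
have pv := pc 1 H1 v Lv; rewrite mul1g in pv.
have := qc _ Hw v Lv; rewrite mulgVK => qv.
exact: reach_det det_T (pv vE) (qv vE).
Qed.

Lemma vertices_coset C : vertices S C <-> exists2 p, p \in V & C = coset p.
Proof.
rewrite stallings_vertex; split=> [[u [v [Lw Hw ->]]]|[p pV ->]].
  have := loop_read Lw Hw; rewrite /enc map_cat => /reach_split[p pu _].
  by exists p; [exact: reach_verts pu | rewrite (reach_TG_coset pu)].
by have [u [v [Lw Hw pu]]] := vert_access pV; exists u, v; rewrite (reach_TG_coset pu).
Qed.

Lemma edges_coset p a q : p \in V -> q \in V ->
  (exists2 e, e \in certG c & [/\ src e = p, lab e = enc_alpha a & tgt e = q]) <->
  edges S (coset p, a, coset q).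
Proof.
move=> pV qV; rewrite stallings_edge; split=> [[e eG [ep ea eq]]|].
  have [t [y [u [v [te ty [Lw Hw] tu _]]]]] := edge_loop eG.
  have tuy : tgt t \in reach TG [:: Leaf] (enc (rcons u y)).
    rewrite /enc map_rcons reach_rcons; apply/nstepP; exists t; split=> //.
    by apply/bothP; exists e.
  exists u, y, v; split=> //; rewrite -(reach_TG_coset tu) -(reach_TG_coset tuy).
  move: te ty; rewrite !inE; case: (y) => b i /orP[]/eqP->; rewrite /src /lab /tgt /=;
  rewrite -/(src e) -/(lab e) -/(tgt e) ep ea eq => -[/enc_alpha_inj->];
  by case: i.
(* Conversely, the [L]-word through the Stallings edge is read in [EG]; the edge crossed there has
   the right cosets at its ends, which are [p] and [q] by [coset_inj]. *)
move=> [u [y [v [Lw Hw E]]]].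
have := loop_read Lw Hw; rewrite -cat_rcons /enc map_cat => /reach_split[q' q'u _].
have := q'u; rewrite map_rcons reach_rcons => /nstepP[t [tT p'u ty tq']].
have p'V := reach_verts p'u; have q'V := reach_verts q'u.
move: E; rewrite -(reach_TG_coset p'u) -(reach_TG_coset q'u) -tq'.
move: q'V; rewrite -tq' => q'V.
move/bothP: tT => [e eG te]; move: te ty q'V p'V {q'u p'u tq'}; rewrite !inE.
case: y {Lw Hw} => b i /orP[]/eqP->; rewrite /src /lab /tgt /=;
rewrite -/(src e) -/(lab e) -/(tgt e) => -[eb]; case: i => // _ q'V p'V [pE -> qE];
by exists e => //; split=> //; apply: coset_inj.
Qed.

Lemma edge_label e : e \in certG c -> exists a : A, lab e = enc_alpha a.
Proof.
move=> /edge_loop[t [[a b] [_ [_ [+ + _ _ _]]]]].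
by rewrite !inE => /orP[]/eqP-> [aE _]; exists a.
Qed.

(** A prefix [u] of an [L]-word of [H] leads in [EG] to a vertex [p], and [mu u * (N p)^-1] lies in
    [H]. As [V] is finite, words of bounded length represent all the [(N p)^-1]. *)
Lemma certified_quasi_convex : quasi_convex mu L H.
Proof.
have [k Hk] : exists k, forall p, p \in V -> exists2 w, size w <= k & mu w = (N p)^-1.
  elim: (V) => [|p l [k IH]]; first by exists 0.
  have [w wE] := mu_surj (N p)^-1; exists (maxn k (size w)) => q.
  rewrite inE => /orP[/eqP->|/IH[w' w'k w'E]]; first by exists w; rewrite ?leq_maxr.
  by exists w' => //; apply: leq_trans w'k (leq_maxl _ _).
exists k => w [Lw Hw] u /prefixP[v wE].
have := loop_read Lw Hw; rewrite wE /enc map_cat => /reach_split[p pu _].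
have [w' w'k w'E] := Hk p (reach_verts pu).
exists (mu u * mu w'); last by exists w'.
by rewrite w'E; apply/rcoset_eq; rewrite -(reach_TG_coset pu).
Qed.

Lemma certified_graph : 1 < #|A| -> exists2 Gamma : finite_graph A,
  output x c = enc_graph Gamma & isomorphic (graph_of Gamma) S.
Proof.
move=> A1; have /card_gt0P[a0 _] : 0 < #|A| by apply: ltnW.
(* The default serves for trees that are not codes of letters; the labels of [certG c] are codes, by
   [edge_label]. *)
pose dec l := odflt a0 [pick a : A | enc_alpha a == l].
have decK e : e \in certG c -> enc_alpha (dec (lab e)) = lab e.
  move=> /edge_label[a ->]; rewrite /dec; case: pickP => [b /eqP//|/(_ a)].
  by rewrite eqxx.
(* The use of [inord] is possible since [V] starts with [Leaf]. *)
pose ix p : 'I_(size V) := inord (index p V).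
have ixE p : p \in V -> nat_of_ord (ix p) = index p V.
  by move=> pV; rewrite /ix inordK //; move: pV; rewrite -index_mem.
have nthV (i : 'I_(size V)) : nth Leaf V i \in V by rewrite mem_nth.
have ixK p : p \in V -> nth Leaf V (ix p) = p by move=> pV; rewrite ixE // nth_index.
have srcV e : e \in certG c -> src e \in V.
  by move=> eG; apply/mem_verts; right; exists e; auto.
have tgtV e : e \in certG c -> tgt e \in V.
  by move=> eG; apply/mem_verts; right; exists e; auto.
have rootV : Leaf \in V by rewrite mem_head.
have uV : uniq V by rewrite /V /verts /= undup_uniq mem_undup mem_filter.
have Vix (i : 'I_(size V)) : ix (nth Leaf V i) = i by apply/val_inj; rewrite /= ixE // index_uniq.
exists (@FiniteGraph A (size V) (ix Leaf)
  [seq (ix (src e), dec (lab e), ix (tgt e)) | e <- certG c]).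
  rewrite /output /enc_graph /= enc_seqE -map_comp /enc_ord ixE //.
  congr (Node _ (Node _ (ofseq _))); apply/eq_in_map => e eG.
  by rewrite /= /enc_edge /enc_pair /enc_ord /= !ixE ?decK; auto.
exists (fun i => coset (nth Leaf V i)); split.
- split=> [i _|i j _ _ /coset_inj ij|C /vertices_coset[p pV ->]].
  + by apply/vertices_coset; exists (nth Leaf V i).
  + by rewrite -[i]Vix -[j]Vix ij.
  + by exists (ix p) => //=; rewrite ixK.
- by rewrite /= ixK // /coset /N rcoset1.
- move=> i a j _ _; rewrite -edges_coset //=; split=> [/mapP[e eG [-> -> ->]]|].
    by exists e => //; rewrite !ixK ?decK; auto.
  move=> [e eG [ei ea ej]]; apply/mapP; exists e => //.
  by rewrite ei ej !Vix; congr (_, _, _); apply/enc_alpha_inj; rewrite decK.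
Qed.

End Soundness.

(** * Existence of certificates *)

Section Completeness.

(** * Words chosen as names of the cosets *)

Lemma enc_wordE (w : word A) : enc_word w = ofseq (enc w).
Proof. exact: enc_seqE. Qed.

Lemma tlist_enc_word (w : word A) : tlist (enc_word w) = enc w.
Proof. exact: tlist_enc_seq. Qed.

Lemma enc_word_inj : injective (@enc_word A).
Proof.
move=> u v /(congr1 tlist); rewrite !tlist_enc_word.
exact: (inj_map (@enc_letter_inj A)).
Qed.

Let coset (w : word A) := rcoset H (mu w).

Lemma coset_cat u u' v : coset u = coset u' -> coset (u ++ v) = coset (u' ++ v).
Proof. by rewrite /coset !mu_cat; apply: rcosetM. Qed.

Lemma coset_rcons u u' y : coset u = coset u' -> coset (rcons u y) = coset (rcons u' y).
Proof. by rewrite -!cats1; apply: coset_cat. Qed.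

(** The coset [H] gets the empty word, so that the root is named [Leaf]; the other cosets get an
    arbitrary word. *)
Definition coset_word (C : set G) : word A :=
  if `[< C = H >] then [::] else xget [::] [set w | coset w = C]%classic.

Lemma coset_wordK w : coset (coset_word (coset w)) = coset w.
Proof.
rewrite /coset_word; case: asboolP => [->|_]; first by rewrite /coset mu_nil rcoset1.
by apply: (xgetPex [::] (P := [set u | coset u = coset w]%classic)); exists w.
Qed.

Definition vert (w : word A) : tree := enc_word (coset_word (coset w)).

Lemma vert_nil : vert [::] = Leaf.
Proof. by rewrite /vert /coset mu_nil rcoset1 /coset_word asboolT. Qed.

Lemma vert_eq u v : vert u = vert v <-> coset u = coset v.
Proof.
split=> [/enc_word_inj E|E]; last by rewrite /vert E.
by rewrite -(coset_wordK u) -(coset_wordK v) E.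
Qed.

Lemma vert_root w : H (mu w) -> vert w = Leaf.
Proof. by move=> Hw; rewrite -vert_nil; apply/vert_eq; rewrite /coset mu_nil rcoset1; apply/rcoset_H. Qed.

Definition step w y : tree := Node (Node (vert w) (enc_letter y)) (vert (rcons w y)).

Lemma step_eq u v y : coset u = coset v -> step u y = step v y.
Proof.
move=> E; rewrite /step (vert_eq u v).2 //.
by rewrite ((vert_eq (rcons u y) (rcons v y)).2 (coset_rcons _ E)).
Qed.

Lemma reach_steps T w v : (forall u y v', v = u ++ y :: v' -> step (w ++ u) y \in T) ->
  vert (w ++ v) \in reach T [:: vert w] (enc v).
Proof.
elim/last_ind: v => [|v y IH] stepT; first by rewrite cats0 inE.
rewrite /enc map_rcons reach_rcons; apply/nstepP; exists (step (w ++ v) y); split=> //.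
- by apply: (stepT _ _ [::]); rewrite cats1.
- by apply: IH => u z v' vE; apply: (stepT _ _ (rcons v' y)); rewrite vE rcons_cat.
- by rewrite /tgt /= rcons_cat.
Qed.

(** ** Balls of the Schreier graph *)

(** The distance is measured in the Schreier graph, from the root to the coset of [w]. *)
Definition inball R w := exists2 u, size u <= R & coset u = coset w.

Lemma inball_mono R R' w : R <= R' -> inball R w -> inball R' w.
Proof. by move=> RR' [u uR uw]; exists u => //; apply: leq_trans RR'. Qed.

Lemma inball_eq R u v : coset u = coset v -> inball R u -> inball R v.
Proof. by move=> uv [w wR wu]; exists w; rewrite ?wu. Qed.

Lemma inball_size w : inball (size w) w. Proof. by exists w. Qed.

Definition words R : seq (word A) :=
  flatten [seq [seq tval t | t : n.-tuple (letter A)] | n <- iota 0 R.+1].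

Lemma mem_words R w : (w \in words R) = (size w <= R).
Proof.
apply/flatten_mapP/idP => [[n]|wR].
  by rewrite mem_iota ltnS => /= nR /mapP[t _ ->]; rewrite size_tuple.
exists (size w); first by rewrite mem_iota ltnS.
by apply/mapP; exists (in_tuple w); rewrite ?mem_enum.
Qed.

Definition arc w a : tree := Node (Node (vert w) (enc_alpha a)) (vert (rcons w (a, false))).

(** The induced subgraph on the ball. Several words may name one source, but [arc] depends on the
    coset only. *)
Definition ball R : seq tree :=
  [seq arc p.1 p.2 | p <- [seq p <- [seq (w, a) | w <- words R, a <- enum A]
                              | `[< inball R (rcons p.1 (p.2, false)) >]]].

Lemma ballP R e : e \in ball R <->
  exists w a, [/\ inball R w, inball R (rcons w (a, false)) & e = arc w a].
Proof.
split=> [/mapP[[w a]]|[w [a [[u uR uw] Ra ->]]]].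
  rewrite mem_filter => /andP[/asboolP Ra /allpairsP[[w' a'] [/= wR _ [wE aE]]] ->].
  exists w, a; split=> //; exists w => //.
  by rewrite -mem_words wE.
apply/mapP; exists (u, a); last first.
  rewrite /arc /= (vert_eq w u).2 ?uw //.
  by rewrite (vert_eq (rcons w (a, false)) (rcons u (a, false))).2 //; apply: coset_rcons.
rewrite mem_filter; apply/andP; split.
  by apply/asboolP; apply: inball_eq Ra; apply: coset_rcons.
by apply/allpairsP; exists (u, a); rewrite mem_words mem_enum.
Qed.

Lemma coset_linv w y : coset (rcons (rcons w y) (linv y)) = coset w.
Proof. by rewrite /coset !mu_rcons mu_linv mulgK. Qed.

Lemma step_linv w a : step (rcons w (a, false)) (a, true) =
  Node (Node (vert (rcons w (a, false))) (enc_letter (a, true))) (vert w).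
Proof. by congr Node; apply/vert_eq; apply: (coset_linv w (a, false)). Qed.

Lemma both1_arc w a : both1 (arc w a) =
  [:: step w (a, false); step (rcons w (a, false)) (a, true)].
Proof. by rewrite step_linv. Qed.

Lemma both_ballP R t : t \in both (ball R) <->
  exists w y, [/\ inball R w, inball R (rcons w y) & t = step w y].
Proof.
split=> [/bothP[e /ballP[w [a [wR aR ->]]]]|[w [[a b] [wR aR ->]]]].
  rewrite both1_arc !inE => /orP[]/eqP->; first by exists w, (a, false).
  exists (rcons w (a, false)), (a, true); split=> //; apply: inball_eq wR.
  by rewrite (coset_linv w (a, false)).
case: b aR => aR; apply/bothP.
  exists (arc (rcons w (a, true)) a).
    apply/ballP; exists (rcons w (a, true)), a; split=> //; apply: inball_eq wR.
    by rewrite (coset_linv w (a, true)).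
  rewrite both1_arc !inE; apply/orP; right; apply/eqP; apply: step_eq.
  by rewrite (coset_linv w (a, true)).
exists (arc w a); first by apply/ballP; exists w, a.
by rewrite both1_arc mem_head.
Qed.

Lemma ball_det R : deterministic (both (ball R)).
Proof.
apply/allP => t /both_ballP[w [y [_ _ ->]]]; apply/allP => t' /both_ballP[w' [y' [_ _ ->]]].
apply/implyP => /andP[/eqP/vert_eq ww' /eqP/enc_letter_inj <-].
by rewrite (step_eq y ww').
Qed.

Lemma reach_ball R w v q : q \in reach (both (ball R)) [:: vert w] (enc v) -> q = vert (w ++ v).
Proof.
elim/last_ind: v q => [|v y IH] q; first by rewrite inE cats0 => /eqP.
rewrite /enc map_rcons reach_rcons => /nstepP[t [/both_ballP[w' [y' [_ _ ->]]] /IH]].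
move=> /vert_eq ww' /enc_letter_inj-> <-; rewrite -rcons_cat.
by apply/vert_eq/coset_rcons.
Qed.

(** ** Certificates of equalities in the group *)

Lemma product_of_generators g : H g -> exists2 zs : seq (word A),
  {subset zs <= hs ++ map winvw hs} & mu (flatten zs) = g.
Proof.
move: g; apply: generated_min => [|h hhs]; last first.
  exists [:: h]; rewrite /= ?cats0 // => z; rewrite inE => /eqP->.
  by rewrite mem_cat hhs.
split=> [|g g' [zs zsP <-] [zs' zs'P <-]|g [zs zsP <-]].
- by exists [::]; rewrite ?mu_nil.
- exists (zs ++ zs'); last by rewrite flatten_cat mu_cat.
  by move=> z; rewrite mem_cat => /orP[/zsP|/zs'P].
(* The inverse of a product is the reversed product of the inverses, and the list of generators with
   their formal inverses is closed under inversion in the group. *)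
elim: zs zsP => [|z zs IH] zsP; first by exists [::]; rewrite //= mu_nil invg1.
have [|zs' zs'P zs'E] := IH; first by move=> z' z'z; apply: zsP; rewrite inE z'z orbT.
have [z1 z1P z1E] : exists2 z1, z1 \in hs ++ map winvw hs & mu z1 = (mu z)^-1.
  have := zsP z (mem_head _ _); rewrite mem_cat => /orP[zh|/mapP[h hh ->]].
    by exists (winvw z); rewrite ?mu_winvw // mem_cat map_f ?orbT.
  by exists h; rewrite ?mu_winvw ?invgK // mem_cat hh.
exists (rcons zs' z1).
  by move=> z'; rewrite mem_rcons inE => /orP[/eqP->|/zs'P].
by rewrite flatten_rcons mu_cat zs'E z1E /= mu_cat invgM.
Qed.

Lemma check_cayley_cat C C' :
  check_cayley x (C ++ C') = check_cayley x C && check_cayley x C'.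
Proof. exact: all_cat. Qed.

Lemma cert_edges_cat C C' : cert_edges (C ++ C') = cert_edges C ++ cert_edges C'.
Proof. exact: map_cat. Qed.

(** A path of [L]-words from [w0] that reads [w] and ends at [v], each step certified by a
    multiplier. *)
Definition chain C w0 w v :=
  [/\ check_cayley x C, L v, mu v = mu w0 * mu w &
      enc_word v \in reach (cert_edges C) [:: enc_word w0] (enc w)].

(** The last word [v'] may be prescribed, so two chains for equal elements can be made to meet. *)
Lemma chain_rcons C w0 w v y v' : chain C w0 w v -> L v' -> mu v' = mu w0 * mu (rcons w y) ->
  exists C', chain C' w0 (rcons w y) v'.
Proof.
move=> [cC Lv vE reachv] Lv' v'E; pose z := map (@enc_optpair A) (pad v v').
pose k := Node (enc_letter y) (ofseq z); exists (C ++ [:: k]); split=> //.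
  rewrite check_cayley_cat cC /= andbT; apply/hasP.
  exists (Node (enc_letter y) (enc_multiplier (multiplier D (Some y)))).
    by apply/multipliersP; exists y.
  rewrite /= eqxx ofseqK; apply/accepts_multiplier; exists v, v'; split=> //.
  by rewrite mu_cat vE v'E mu_rcons mulgA.
rewrite /enc map_rcons reach_rcons; apply/nstepP.
exists (Node (Node (enc_word v) (enc_letter y)) (enc_word v')); split=> //.
  rewrite cert_edges_cat mem_cat; apply/orP; right.
  by rewrite /cert_edges /= ofseqK !proj_pad -!enc_wordE mem_head.
by apply: reach_mono reachv => // t tC; rewrite cert_edges_cat mem_cat tC.
Qed.

Lemma chain_exists w0 w : L w0 -> exists C v, chain C w0 w v.
Proof.
move=> Lw0; elim/last_ind: w => [|w y [C [v Cv]]].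
  by exists [::], w0; split; rewrite ?mu_nil ?mulg1 ?inE.
have [v' Lv' v'E] := representative (mu w0 * mu (rcons w y)).
by have [C' Cv'] := chain_rcons Cv Lv' v'E; exists C', v'.
Qed.

Lemma check_sound1_mono C C' k e : {subset C <= C'} ->
  check_sound1 x C k e -> check_sound1 x C' k e.
Proof.
move=> sC; have sE : {subset cert_edges C <= cert_edges C'}.
  by move=> t /mapP[d dC ->]; apply: map_f; apply: sC.
move=> /andP[/andP[kz k1] k2]; apply/andP; split; first (apply/andP; split=> //).
  by apply: reach_mono k1.
by apply: reach_mono k2.
Qed.

(** The chosen words satisfy [r a = z r'] in the group, with [z] a product of generators and their
    inverses. Chains from a common [w0] along both sides witness this. *)
Lemma sound_arc w a : exists C k, check_cayley x C /\ check_sound1 x C k (arc w a).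
Proof.
pose r := coset_word (coset w); pose r' := coset_word (coset (rcons w (a, false))).
have Hr : H (mu (rcons r (a, false)) * (mu r')^-1).
  apply/rcoset_eq; rewrite -/(coset _) -/(coset r') coset_wordK.
  by apply: coset_rcons; apply: coset_wordK.
have [zs zsP zsE] := product_of_generators Hr.
have [w0 Lw0 _] := representative 1.
have [C1 [v c1]] := chain_exists (flatten zs ++ r') Lw0.
have [C2 [v' c2]] := chain_exists r Lw0.
have [cC1 Lv vE vreach] := c1.
(* The second chain is forced to end at the word [v] reached by the first. *)
have [|C3 [cC3 _ _ v3]] := chain_rcons (y := (a, false)) c2 Lv.
  by rewrite vE mu_cat zsE mulgVK.
exists (C1 ++ C3), (Node (ofseq (map (@enc_word A) zs)) (Node (enc_word w0) (enc_word v))).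
split; first by rewrite check_cayley_cat cC1.
rewrite /check_sound1 /= ofseqK /src /lab /tgt /= !tlist_enc_word -/r -/r'.
apply/andP; split; first (apply/andP; split).
- by apply/allP => _ /mapP[z zz ->]; rewrite gens_invE map_f // zsP.
- rewrite -map_comp (eq_map (g := enc)); last exact: tlist_enc_word.
  rewrite -[flatten _]/(flatten (map (map _) zs)) -map_flatten -map_cat.
  by apply: reach_mono vreach => // t tC; rewrite cert_edges_cat mem_cat tC.
- rewrite cats1 -[Node (enc_alpha a) Leaf]/(enc_letter (a, false)) -map_rcons.
  by apply: reach_mono v3 => // t tC; rewrite cert_edges_cat mem_cat tC orbT.
Qed.

Lemma list_choice (Q : eqType) (l : seq Q) (P : Q -> tree -> Prop) :
  (forall s, s \in l -> exists t, P s t) ->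
  exists ts : seq tree, forall s, s \in l -> exists2 t, t \in ts & P s t.
Proof.
elim: l => [|s l IH] lP; first by exists [::].
have [|ts tsP] := IH; first by move=> s' s'l; apply: lP; rewrite inE s'l orbT.
have [t st] := lP s (mem_head _ _); exists (t :: ts) => s'.
rewrite inE => /orP[/eqP->|/tsP[t' t'ts s't']]; first by exists t; rewrite ?mem_head.
by exists t'; rewrite // inE t'ts orbT.
Qed.

Lemma sound_ball R : exists C Z, check_cayley x C /\ check_sound x (ball R) C Z.
Proof.
have [C [cC CP]] : exists C, check_cayley x C /\
    forall e, e \in ball R -> exists k, check_sound1 x C k e.
  have : forall e, e \in ball R -> exists w a, e = arc w a.
    by move=> e /ballP[w [a [_ _ ->]]]; exists w, a.
  elim: (ball R) => [|e E IH] arcE; first by exists [::].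
  have [|C [cC CP]] := IH; first by move=> e' e'E; apply: arcE; rewrite inE e'E orbT.
  have [w [a eE]] := arcE e (mem_head _ _); have [C' [k [cC' C'k]]] := sound_arc w a.
  exists (C ++ C'); rewrite check_cayley_cat cC cC'; split=> // e'.
  rewrite inE => /orP[/eqP->|/CP[k' Ck']].
    by exists k; rewrite eE; apply: check_sound1_mono C'k => d dC; rewrite mem_cat dC orbT.
  by exists k'; apply: check_sound1_mono Ck' => d dC; rewrite mem_cat dC.
have [Z ZP] := list_choice CP; exists C, Z; split=> //.
by apply/allP => e /ZP[k kZ Ck]; apply/hasP; exists k.
Qed.

(** ** Invariants *)

(** A finite list of all possible values of [reach] from the root: after a nonempty word, the value
    is the list of targets of a sublist of [T], given by a mask. *)
Definition succs (T : seq tree) : seq (seq tree) :=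
  [:: Leaf] :: [seq map tgt (mask (tval b) T) | b : (size T).-tuple bool].

Lemma mem_succs T w : reach T [:: Leaf] w \in succs T.
Proof.
case/lastP: w => [|w y]; first exact: mem_head.
rewrite reach_rcons inE; apply/orP; right.
have sz : size (map (fun t => (src t \in reach T [:: Leaf] w) && (lab t == y)) T) == size T.
  by rewrite size_map.
by apply/mapP; exists (Tuple sz); rewrite ?mem_enum //= -filter_mask.
Qed.

Lemma mem_reach T S0 w q : q \in reach T S0 w -> q \in S0 ++ map tgt T.
Proof.
case/lastP: w => [|w y]; first by rewrite mem_cat => ->.
rewrite reach_rcons => /nstepP[t [tT _ _ <-]].
by rewrite mem_cat map_f ?orbT.
Qed.

Definition reachable M Ta Tb i := exists z m,
  m \in reach (aut_trans M) (aut_initial M) z /\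
  i = triple m (reach Ta [:: Leaf] (proj tfst z)) (reach Tb [:: Leaf] (proj tsnd z)).

(** The triples that actually occur form an invariant, and they are finitely many: the states come
    from the automaton and the two lists from [succs]. *)
Lemma invariant_exists M Ta Tb : exists I, invariant M Ta Tb (tlist I) /\
  forall i, i \in tlist I -> reachable M Ta Tb i.
Proof.
pose cand := [seq triple p.1 p.2 S2 |
  p <- [seq (m, S1) | m <- aut_initial M ++ map tgt (aut_trans M), S1 <- succs Ta],
  S2 <- succs Tb].
pose I := [seq i <- cand | `[< reachable M Ta Tb i >]].
have memI i : reachable M Ta Tb i -> i \in I.
  move=> ri; rewrite mem_filter asboolT //=; move: ri => [z [m [mz ->]]]; rewrite /cand.
  apply/allpairsP; exists ((m, reach Ta [:: Leaf] (proj tfst z)),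
    reach Tb [:: Leaf] (proj tsnd z)); split; [|exact: mem_succs|by []].
  apply/allpairsP; exists (m, reach Ta [:: Leaf] (proj tfst z)).
  by split; [exact: mem_reach mz|exact: mem_succs|].
exists (ofseq I); rewrite ofseqK; split; last first.
  by move=> i; rewrite mem_filter => /andP[/asboolP].
apply/andP; split.
  by apply/allP => m mI; apply: memI; exists [::], m.
apply/allP => i; rewrite mem_filter => /andP[/asboolP[z [m [mz ->]]] _].
apply/allP => t tM; apply/implyP; rewrite /state1 /state2 /= !ofseqK => /eqP tm.
apply: memI; exists (rcons z (lab t)), (tgt t); split.
  by rewrite reach_rcons; apply/nstepP; exists t; rewrite tm.
by rewrite !(reach_proj _ _ _ (rcons _ _)) !foldl_rcons -!reach_proj.
Qed.

(** ** Fellow travellers *)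

(** After column [i] the multiplier is in a state with a short completion [z']. The pair completed
    by [a] and [b] is again accepted, so [a], [y] and the inverse of [b] lead from [take i u] to
    [take i v]. *)
Lemma fellow_traveller y : exists n, forall u v, L u -> L v -> mu u * mu [:: y] = mu v ->
  forall i, exists2 w, size w <= n & mu (take i u) * mu w = mu (take i v).
Proof.
have [n nP] := bounded_completion (multiplier D (Some y)).
(* Two completions of length at most [n] and the letter [y]. *)
exists (n + 1%N + n) => u v Lu Lv uv i.
have [_ _ /(_ (Some y)) accE] := autD.
have : accepted (multiplier D (Some y)) (pad u v).
  by rewrite accE; exists u, v; rewrite mu_cat.
move=> [p [q [pI qF]]]; rewrite -{1}(cat_take_drop i (pad u v)) => /run_cat[r pr rq].
have [z' [q' [z'n q'F rz'q']]] := nP _ _ _ qF rq.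
have : accepted (multiplier D (Some y)) (take i (pad u v) ++ z').
  by exists p, q'; split=> //; apply/run_cat; exists r.
rewrite accE => -[u' [v' [_ _ + zE]]].
have [tu tv] := pmap_take_pad u v i.
have [uE vE] := pmap_pad u' v'; rewrite -uE -[in RHS]vE -zE !pmap_cat tu tv /=.
set a := pmap fst z'; set b := pmap snd z'; rewrite !mu_cat => E.
exists ((a ++ [:: y]) ++ winvw b).
  rewrite !size_cat /winvw size_rev size_map /=.
  by rewrite !leq_add ?(leq_trans _ z'n) // size_pmap count_size.
by rewrite !mu_cat mu_winvw !mulgA E mulgK.
Qed.

(** ** The certificate of a quasi-convex subgroup *)

Hypothesis QC : quasi_convex mu L H.

Lemma loops_bounded : exists R, forall w u, L w -> H (mu w) -> prefix u w -> inball R u.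
Proof.
have [k kP] := QC; exists k => w u Lw Hw uw.
have [h Hh [w' w'k w'E]] := kP w (conj Lw Hw) u uw.
exists (winvw w'); first by rewrite /winvw size_rev size_map.
apply/rcoset_eq; rewrite mu_winvw -invgM; apply: HV.
by rewrite w'E.
Qed.

(** Induction on [w]: quasi-convexity settles the coset [H], and each further letter enlarges the
    radius by the fellow traveller constant. *)
Lemma coset_bounded w : exists R, forall v u, L v -> coset v = coset w ->
  prefix u v -> inball R u.
Proof.
elim/last_ind: w => [|w y [R RP]].
  have [R RP] := loops_bounded; exists R => v u Lv vE; apply: RP => //.
  by apply/rcoset_H; rewrite -/(coset v) vE /coset mu_nil rcoset1.
have [n nP] := fellow_traveller y; exists (R + n) => v u Lv vE uv.
(* An [L]-word [v0] in the previous coset that [v] fellow-travels. *)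
have [v0 Lv0 v0E] := representative (mu v * (mu [:: y])^-1).
have [|w' w'n w'E] := nP v0 v Lv0 Lv _ (size u); first by rewrite v0E mulgVK.
have [||w0 w0R w0E] := RP v0 (take (size u) v0) Lv0.
- by rewrite -(coset_linv w y) -cats1 -(coset_cat _ vE) /coset mu_cat mu_linv v0E.
- exact: prefix_take.
exists (w0 ++ w'); first by rewrite size_cat leq_add.
rewrite (coset_cat w' w0E) /coset mu_cat w'E.
by move: uv; rewrite prefixE => /eqP->.
Qed.

Lemma coset_bounded_ball R : exists R', forall w v u, inball R w -> L v ->
  coset v = coset w -> prefix u v -> inball R' u.
Proof.
have [R' R'P] : exists R', forall w, w \in words R -> forall v u, L v ->
    coset v = coset w -> prefix u v -> inball R' u.
  elim: (words R) => [|w l [R1 R1P]]; first by exists 0.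
  have [R2 R2P] := coset_bounded w; exists (maxn R1 R2) => w'.
  rewrite inE => /orP[/eqP->|w'l] v u Lv vE uv.
    exact: inball_mono (leq_maxr _ _) (R2P v u Lv vE uv).
  exact: inball_mono (leq_maxl _ _) (R1P w' w'l v u Lv vE uv).
exists R' => w v u [w' w'R w'w] Lv vw; apply: (R'P w') => //.
  by rewrite mem_words.
by rewrite vw.
Qed.

Lemma reach_inball R v : (forall u, prefix u v -> inball R u) ->
  vert v \in reach (both (ball R)) [:: Leaf] (enc v).
Proof.
move=> vR; rewrite -vert_nil; apply: (reach_steps (w := [::])) => u y v' vE.
apply/both_ballP; exists u, y; split=> //; apply: vR; rewrite vE.
  exact: prefix_prefix.
by rewrite -cat_rcons prefix_prefix.
Qed.

Definition loop_arc e := exists u y v,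
  [/\ L (u ++ y :: v), H (mu (u ++ y :: v)) & step u y \in both1 e].

Definition loop_arcs R := [seq e <- ball R | `[< loop_arc e >]].

Lemma certificate_exists : exists c, check x c.
Proof.
have [R1 R1P] := loops_bounded.
(* [E0] has to contain the loops of the [L]-words of [H] and those of the generators. *)
pose R0 := maxn R1 (\max_(h <- hs) size h).
(* [E] has to contain [E0] and every [L]-word representing an element of a coset of the ball of
   radius [R0]. *)
have [R2 R2P] := coset_bounded_ball R0; pose R := maxn R0 R2.
have loopR w u : L w -> H (mu w) -> prefix u w -> inball R0 u.
  by move=> Lw Hw uw; apply: inball_mono (leq_maxl _ _) (R1P w u Lw Hw uw).
have sub0 : {subset ball R0 <= ball R}.
  move=> e /ballP[w [a [wR aR ->]]]; apply/ballP; exists w, a.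
  by split=> //; apply: inball_mono (leq_maxl _ _) _.
have subG : {subset loop_arcs R0 <= ball R0} by move=> e; rewrite mem_filter => /andP[].
have stepG u y v : L (u ++ y :: v) -> H (mu (u ++ y :: v)) -> step u y \in both (loop_arcs R0).
  move=> Lw Hw; have : step u y \in both (ball R0).
    apply/both_ballP; exists u, y; split=> //; apply: (loopR _ _ Lw Hw).
      exact: prefix_prefix.
    by rewrite -cat_rcons prefix_prefix.
  move=> /bothP[e eR ue]; apply/bothP; exists e => //.
  by rewrite mem_filter eR andbT; apply/asboolP; exists u, y, v.
have reachG u v v' : L (u ++ v ++ v') -> H (mu (u ++ v ++ v')) ->
    vert (u ++ v) \in reach (both (loop_arcs R0)) [:: vert u] (enc v).
  move=> Lw Hw; apply: reach_steps => u' y v1 vE.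
  by apply: (stepG _ _ (v1 ++ v')); move: Lw Hw; rewrite vE -!catA /=.
have [C [Z [cC cZ]]] := sound_ball R.
have [Is1 Is1P] : exists Is : seq tree, forall m, m \in multipliers x ->
    exists2 I, I \in Is & invariant (tsnd m) (both (ball R)) (both (ball R)) (tlist I) /\
      forall i, i \in tlist I -> reachable (tsnd m) (both (ball R)) (both (ball R)) i.
  by apply: list_choice => m _; apply: invariant_exists.
pose M1 := tfst (tsnd (tsnd (tfst x))).
have [I1 [I1inv I1P]] := invariant_exists M1 (both (ball R)) (both (loop_arcs R0)).
have [W WP] : exists W : seq tree, forall e, e \in loop_arcs R0 -> exists2 w, w \in W &
    has (fun t => [&& accepts (tfst (tsnd (tfst x))) (tlist (tfst w) ++ lab t :: tlist (tsnd w)),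
        src t \in reach (both (loop_arcs R0)) [:: Leaf] (tlist (tfst w)) &
        Leaf \in reach (both (loop_arcs R0)) [:: tgt t] (tlist (tsnd w))]) (both1 e).
  apply: list_choice => e; rewrite mem_filter => /andP[/asboolP[u [y [v [Lw Hw ue]]]] _].
  exists (Node (enc_word u) (enc_word v)); apply/hasP; exists (step u y) => //=.
  rewrite !tlist_enc_word -[_ ++ _]/(enc u ++ enc (y :: v)) -map_cat.
  apply/and3P; split; first exact/accepts_enc.
    by rewrite -vert_nil; apply: (reachG [::] u (y :: v)).
  rewrite -(vert_root Hw) -cat_rcons; apply: (reachG (rcons u y) v [::]);
  by rewrite cats0 cat_rcons.
have [w1 Lw1 w1E] := representative 1.
have root_ball : inball R0 [::] by exists [::].
have reachL w v : inball R0 w -> L v -> coset v = coset w ->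
    vert v \in reach (both (ball R)) [:: Leaf] (enc v).
  move=> wR Lv vw; apply: reach_inball => u uv.
  by apply: inball_mono (leq_maxr _ _) _; apply: R2P wR Lv vw uv.
exists (certificate (loop_arcs R0) (ball R0) (ball R) (I1 :: Is1) C Z (enc_word w1 :: W)).
rewrite /check !certificateE.
apply/andP; split; [apply/andP; split; [apply/andP; split; [apply/andP; split|]|]|].
- by apply/andP; split; apply/allP.
- by rewrite ball_det cC.
- rewrite cZ /=; apply/allP => h; rewrite gensE => /mapP[h' h'hs ->].
  (* The prefixes of a generator have length at most [R0], so it is read inside [ball R0]. *)
  rewrite tlist_enc_word -{1}(vert_root (generated_in h'hs)); apply: reach_inball => u uh.
  apply: inball_mono (inball_size u); rewrite leq_max; apply/orP; right.
  by apply: leq_trans (size_prefix uh) _; apply: (leq_bigmax_seq h').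
- apply/andP; split.
    apply/allP => m mx; have [I IIs [Iinv IP]] := Is1P m mx.
    apply/hasP; exists I; first by rewrite inE IIs orbT.
    apply/andP; split=> //.
    apply/allP => i /IP[z [q [qz ->]]]; apply/implyP => /= qF.
    move: mx IP Iinv qz qF => /multipliersP[y ->] /= _ _ qz qF.
    have : accepts (enc_multiplier (multiplier D (Some y))) z by apply/hasP; exists q.
    move=> /accepts_multiplier[u [v [Lu Lv uv ->]]].
    rewrite /state1 /state2 /= !ofseqK !proj_pad.
    (* If [u] leads to the source of an edge [step w y] of [ball R0], then [v] lies in the coset of
       its target, so all of [v] is read in [ball R]. *)
    apply/allP => t /both_ballP[w [y' [wR w'R ->]]].
    apply/implyP => /andP[/eqP/enc_letter_inj yE tu]; subst y'.
    move: tu; rewrite -vert_nil => /reach_ball/vert_eq wu.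
    have wv : coset v = coset (rcons w y).
      by rewrite (coset_rcons y wu) /coset -cats1 -uv.
    have -> : tgt (step w y) = vert v by apply/vert_eq.
    by rewrite vert_nil; apply: (reachL (rcons w y)).
  apply/hasP; exists I1; rewrite ?mem_head //; apply/andP; split=> //.
  apply/allP => i /I1P[z [q [qz ->]]]; apply/implyP => /= qF; apply/implyP.
  have : accepts M1 z by apply/hasP; exists q.
  move=> /accepts_multiplier[u [v [Lu Lv]]]; rewrite cats0 => uv ->.
  (* If [u] loops at the root, [v] represents an element of [H], and its path consists of loop
     arcs. *)
  rewrite /state1 /state2 /= !ofseqK !proj_pad -vert_nil => /reach_ball/vert_eq uE.
  have Hv : H (mu v) by rewrite -uv; apply/rcoset_H; rewrite -/(coset u) -uE /coset mu_nil rcoset1.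
  rewrite [X in X \in _]vert_nil -(vert_root Hv).
  by apply: (reachG [::] v [::]); rewrite cats0.
- apply/andP; split.
    apply/hasP; exists (enc_word w1); rewrite ?mem_head // tlist_enc_word.
    apply/andP; split; first exact/accepts_enc.
    have Hw1 : H (mu w1) by rewrite w1E; apply: H1.
    rewrite -{1}(vert_root Hw1); apply: (reachL [::]) => //.
    by rewrite /coset w1E mu_nil.
  apply/allP => e /WP[w wW /hasP[t te tw]]; apply/hasP; exists t => //.
  by apply/hasP; exists w; rewrite // inE wW orbT.
Qed.

End Completeness.
End Input.

(** * The partial algorithm *)

Theorem theorem4p1 :
  exists P : program,
    forall (A : finType) (G : groupType) (mu : word A -> G)
           (D : automata A) (hs : seq (word A)),
      1 < #|A| ->
      inverse_epimorphism mu ->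
      automatic_structure mu D ->
      all (@reduced A) hs ->
      let L := language D in
      let H := generated mu hs in
      (quasi_convex mu L H ->
         exists2 Gamma : finite_graph A,
           eval P (enc_input D hs) (enc_graph Gamma) &
           isomorphic (graph_of Gamma) (stallings mu L H)) /\
      (~ quasi_convex mu L H -> ~ halts P (enc_input D hs)).
Proof.
have [P PP] := computable_search computable_check computable_output.
exists P => A G mu D hs A1 muP autD _ L H.
have [find none] := PP (enc_input D hs); split=> [QC|nQC].
  (* The search may stop at another certificate [c']; any certificate that passes the check yields
     the Stallings graph. *)
  have [c /find[c' chk Pc']] := certificate_exists muP autD QC.
  have [Gamma outE iso] := certified_graph muP autD chk A1.
  by exists Gamma; rewrite // -outE.
(* A certificate that passes would already prove quasi-convexity. *)
apply: none => c; apply/negP => chk; apply: nQC.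
exact: (certified_quasi_convex muP autD chk).
Qed.
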